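(* Let $n\geq 3$ be an integer and let $\sigma$ be the standard round metric on the sphere $S^n$ (so that $\mathrm{Ric}=(n-1)\sigma$). (i) For every real $C<\frac{4n(n-1)}{(n-2)^2}$ there exist an eigenfunction $f\in C^\infty(S^n)$ of the Laplacian of $\sigma$ and $t_0>0$ such that for all $0<t<t_0$ the tensor $g_t=(1+tf)\sigma$ is a Riemannian metric on $S^n$ with nonnegative Ricci curvature and $$\int_{S^n}\left(R-\overline R\right)^2 \;>\; C\int_{S^n}\left|\mathrm{Ric}-\frac{R}{n}\,g_t\right|^2 .$$ (ii) For every real $C<\frac{n^2}{(n-2)^2}$ there exist an eigenfunction $f\in C^\infty(S^n)$ of the Laplacian of $\sigma$ and $t_0>0$ such that for all $0<t<t_0$ the tensor $g_t=(1+tf)\sigma$ is a Riemannian metric on $S^n$ with nonnegative Ricci curvature and $$\int_{S^n}\left|\mathrm{Ric}-\frac{\overline R}{n}\,g_t\right|^2 \;>\; C\int_{S^n}\left|\mathrm{Ric}-\frac{R}{n}\,g_t\right|^2 .$$ Here all curvatures, norms, averages and integrals in the displayed inequalities are those of $g_t$.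
   Context: For a Riemannian metric $g$ on $S^n$, $\mathrm{Ric}$ is its Ricci tensor, $R$ its scalar curvature (the $g$-trace of $\mathrm{Ric}$), and $\overline R=\frac{1}{\mathrm{vol}(S^n,g)}\int_{S^n}R$ the average of $R$. Integrals are with respect to the Riemannian volume measure of $g$ and $|\cdot|$ is the tensor norm induced by $g$. Nonnegative Ricci curvature means $\mathrm{Ric}(v,v)\geq 0$ for every tangent vector $v$. *)

(* Defs.v *)
From HB Require Import structures.
From mathcomp Require Import all_boot all_order all_algebra.
From mathcomp Require Import ring lra.
From mathcomp Require Import all_classical all_reals all_analysis.

Set Implicit Arguments.
Unset Strict Implicit.
Unset Printing Implicit Defensive.

Import Order.TTheory GRing.Theory Num.Theory.
Import numFieldNormedType.Exports.

Local Open Scope classical_set_scope.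
Local Open Scope ring_scope.

Section cons_measure.
Context d (T : measurableType d) (R : realType) (n : nat).
Local Open Scope ereal_scope.
Variables (m : {sigma_finite_measure set T -> \bar R})
          (mu : {sigma_finite_measure set (n.-tuple T) -> \bar R}).

Definition cons_pair (p : (T * n.-tuple T)%type) : n.+1.-tuple T :=
  [the n.+1.-tuple T of p.1 :: p.2].

Lemma measurable_cons_pair :
  measurable_fun [set: (T * n.-tuple T)%type] cons_pair.
Proof. by apply: measurable_cons; [exact: measurable_fst|exact: measurable_snd]. Qed.

(* The product measure of [m] and [mu], carried over to (n+1)-tuples. *)
Definition cons_measure : set (n.+1.-tuple T) -> \bar R :=
  pushforward (m \x mu) cons_pair.

Let cons_measure0 : cons_measure set0 = 0.
Proof. by rewrite /cons_measure /pushforward preimage_set0 measure0. Qed.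

Let cons_measure_ge0 A : 0 <= cons_measure A.
Proof. by rewrite /cons_measure /pushforward; exact: measure_ge0. Qed.

Let cons_measure_sigma_additive : semi_sigma_additive cons_measure.
Proof.
move=> F mF tF mUF; rewrite /cons_measure /pushforward preimage_bigcup.
have mp (A : set (n.+1.-tuple T)) : measurable A ->
    measurable (cons_pair @^-1` A).
  by move=> mA; rewrite -[X in measurable X]setTI; exact: measurable_cons_pair.
apply: measure_semi_sigma_additive.
- by move=> k; exact: mp.
- apply/trivIsetP => /= i j _ _ ij; rewrite -preimage_setI.
  by move/trivIsetP : tF => /(_ _ _ _ _ ij) ->//; rewrite preimage_set0.
- by rewrite -preimage_bigcup; exact: mp.
Qed.

HB.instance Definition _ := isMeasure.Build _ _ _ cons_measure
  cons_measure0 cons_measure_ge0 cons_measure_sigma_additive.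

Let cons_measure_sigma_finite : sigma_finite setT cons_measure.
Proof.
have /sigma_finiteP[F [TF ndF Foo]] := sigma_finiteT m.
have /sigma_finiteP[G [TG ndG Goo]] := sigma_finiteT mu.
pose split (t : n.+1.-tuple T) : (T * n.-tuple T)%type :=
  (tnth t ord0, [tuple of behead t]).
have msplit : measurable_fun setT split.
  apply/measurable_fun_pairP; split; first exact: measurable_tnth.
  exact: measurable_behead.
have splitK p : split (cons_pair p) = p.
  by case: p => x t; rewrite /split; congr (_, _); exact/val_inj.
exists (fun k => split @^-1` (F k `*` G k)).
  rewrite -preimage_bigcup (_ : \bigcup_k (F k `*` G k) = setT).
    by rewrite preimage_setT.
  rewrite -setXTT TF TG predeqE => -[x y]; split.
    by move=> [k _ []/= ? ?]; split; exists k.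
  move=> [/= [i _ Fix] [j _ Gjy]]; exists (maxn i j) => //; split.
  - by move: x Fix; exact/subsetPset/ndF/leq_maxl.
  - by move: y Gjy; exact/subsetPset/ndG/leq_maxr.
move=> k; have [mFk Fk] := Foo k; have [mGk Gk] := Goo k.
have mFG : measurable (F k `*` G k) by exact: measurableX.
split; first by rewrite -[X in measurable X]setTI; exact: msplit.
rewrite /cons_measure /pushforward -comp_preimage.
rewrite (_ : split \o cons_pair = id); last exact/funext.
by rewrite preimage_id product_measure1E// lte_mul_pinfty// ge0_fin_numE.
Qed.

HB.instance Definition _ := Measure_isSigmaFinite.Build _ _ _ cons_measure
  cons_measure_sigma_finite.

End cons_measure.

Fixpoint power_measure d (T : measurableType d) (R : realType)
    (m : {sigma_finite_measure set T -> \bar R}) (n : nat) :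
    {sigma_finite_measure set (n.-tuple T) -> \bar R} :=
  match n with
  | 0 => dirac ([tuple] : 0.-tuple T)
  | k.+1 => cons_measure m (power_measure m k)
  end.

Definition lebesgue_tuple (R : realType) (n : nat) :
    {sigma_finite_measure set (n.-tuple (measurableTypeR R)) -> \bar R} :=
  power_measure (@lebesgue_measure R) n.

Definition row_of_tuple (R : realType) n (t : n.-tuple R) : 'rV[R]_n :=
  \row_i tnth t i.

Section calculus.
Context (R : realType) (n : nat).

Definition partial (i : 'I_n) (f : 'rV[R]_n -> R) (x : 'rV[R]_n) : R :=
  'D_(delta_mx 0 i) f x.

Fixpoint is_Ck (k : nat) (f : 'rV[R]_n -> R) : Prop :=
  continuous f /\
  match k with
  | 0 => True
  | k'.+1 => forall i, (forall x, derivable f x (delta_mx 0 i)) /\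
                       is_Ck k' (partial i f)
  end.

Definition is_smooth (f : 'rV[R]_n -> R) : Prop := forall k, is_Ck k f.

End calculus.

(* Below, [h x] is the matrix (h_ij(x)) of a metric in local coordinates x. *)

Section local_geometry.
Context (R : realType) (n : nat).
Variable h : 'rV[R]_n -> 'M[R]_n.

Definition metric_inv (x : 'rV[R]_n) : 'M[R]_n := invmx (h x).

(* [christoffel k i j] is Gamma^k_ij for the Levi-Civita connection. *)
Definition christoffel (k i j : 'I_n) (x : 'rV[R]_n) : R :=
  2^-1 * \sum_l metric_inv x k l *
    (partial i (fun y => h y j l) x + partial j (fun y => h y i l) x
     - partial l (fun y => h y i j) x).

(* [riemann l k i j] is the coefficient R^l_kij of
   (nabla_i nabla_j - nabla_j nabla_i) d_k = R^l_kij d_l. *)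
Definition riemann (l k i j : 'I_n) (x : 'rV[R]_n) : R :=
  partial i (christoffel l j k) x - partial j (christoffel l i k) x
  + \sum_m (christoffel l i m x * christoffel m j k x
            - christoffel l j m x * christoffel m i k x).

Definition ricci (x : 'rV[R]_n) : 'M[R]_n :=
  \matrix_(k, j) \sum_l riemann l k l j x.

Definition metric_trace (x : 'rV[R]_n) (T : 'M[R]_n) : R :=
  \sum_i \sum_j metric_inv x i j * T i j.

Definition scalar_curvature (x : 'rV[R]_n) : R := metric_trace x (ricci x).

(* |T|^2 = h^ik h^jl T_ij T_kl *)
Definition tensor_norm_sq (x : 'rV[R]_n) (T : 'M[R]_n) : R :=
  \sum_i \sum_j \sum_k \sum_l
    metric_inv x i k * metric_inv x j l * T i j * T k l.

Definition laplacian (f : 'rV[R]_n -> R) (x : 'rV[R]_n) : R :=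
  metric_trace x (\matrix_(i, j) (partial i (partial j f) x
    - \sum_k christoffel k i j x * partial k f x)).

Definition volume_integral (u : 'rV[R]_n -> R) : R :=
  \int[lebesgue_tuple R n]_t
    (u (row_of_tuple t) * Num.sqrt (\det (h (row_of_tuple t)))).

Definition average (u : 'rV[R]_n -> R) : R :=
  (volume_integral (fun=> 1))^-1 * volume_integral u.

End local_geometry.

Definition dot (R : realType) m (u v : 'rV[R]_m) : R :=
  \sum_i u 0 i * v 0 i.

(* S^n as a subset of R^(1+n). *)
Definition sphere (R : realType) (n : nat) : Type :=
  {p : 'rV[R]_(1 + n) | dot p p == 1}.

Section sphere.
Context (R : realType) (n : nat).

Definition tangent (p : sphere R n) (u : 'rV[R]_(1 + n)) : Prop :=
  dot (val p) u = 0.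

(* Inverse stereographic projections: [stereo false] projects from the pole
   (1, 0) and [stereo true] from the pole (-1, 0). *)
Definition stereo (b : bool) (x : 'rV[R]_n) : 'rV[R]_(1 + n) :=
  row_mx (((-1) ^+ b * ((dot x x - 1) / (1 + dot x x)))%:M)
         ((2 / (1 + dot x x)) *: x).

Lemma stereo_subproof (b : bool) (x : 'rV[R]_n) :
  dot (stereo b x) (stereo b x) == 1.
Proof.
apply/eqP; rewrite {1}/dot big_split_ord/= big_ord1.
under eq_bigr do rewrite row_mxEr mxE mulrACA.
rewrite -mulr_sumr row_mxEl mxE eqxx mulr1n -/(dot x x).
have : 0 <= dot x x.
  by apply: sumr_ge0 => i _; rewrite -expr2 sqr_ge0.
set r := dot x x => r0.
rewrite mulrACA -signr_addb addbb mul1r.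
field.
by rewrite gt_eqF// ltr_pwDl.
Qed.

(* The image of [chart false] omits only (1, 0), that of [chart true] only
   (-1, 0): the two charts form an atlas of S^n. *)
Definition chart (b : bool) (x : 'rV[R]_n) : sphere R n :=
  exist _ (stereo b x) (stereo_subproof b x).

Definition smooth_on_sphere (f : sphere R n -> R) : Prop :=
  forall b, is_smooth (f \o chart b).

(* A covariant 2-tensor field; only its values [g p u v] on vectors [u], [v]
   tangent at [p] are meaningful. *)
Definition tensor_field : Type :=
  sphere R n -> 'rV[R]_(1 + n) -> 'rV[R]_(1 + n) -> R.

(* The functions g_ij = g(d_i, d_j) in the chart [b]. *)
Definition components (g : tensor_field) (b : bool) (x : 'rV[R]_n) : 'M[R]_n :=
  \matrix_(i, j) g (chart b x) ('D_(delta_mx 0 i) (stereo b) x)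
                               ('D_(delta_mx 0 j) (stereo b) x).

Definition is_riemannian_metric (g : tensor_field) : Prop :=
  [/\ forall p a u v w, tangent p u -> tangent p v -> tangent p w ->
        g p (a *: u + v) w = a * g p u w + g p v w,
      forall p u v, tangent p u -> tangent p v -> g p u v = g p v u,
      forall p u, tangent p u -> u != 0 -> 0 < g p u u &
      forall b i j, is_smooth (fun x => components g b x i j)].

(* The coordinate vectors [v] of the chart [b] at [x] parametrise the tangent
   space at [chart b x]. *)
Definition nonneg_ricci (g : tensor_field) : Prop :=
  forall b x (v : 'rV[R]_n),
    0 <= \sum_i \sum_j ricci (components g b) x i j * v 0 i * v 0 j.

Definition round_metric : tensor_field := fun _ u v => dot u v.

Definition is_laplace_eigenfunction (g : tensor_field) (f : sphere R n -> R) :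
    Prop :=
  [/\ smooth_on_sphere f,
      exists p, f p != 0 &
      exists lambda : R, forall b x,
        - laplacian (components g b) (f \o chart b) x = lambda * f (chart b x)].

Definition conformal (u : sphere R n -> R) (g : tensor_field) : tensor_field :=
  fun p v w => u p * g p v w.

(* Integrals over S^n are computed in one chart, whose image has full measure;
   scalar functions on S^n are represented in that chart. *)
Definition main_components (g : tensor_field) : 'rV[R]_n -> 'M[R]_n :=
  components g false.

Definition scalar_deviation (g : tensor_field) : R :=
  let h := main_components g in
  let Rbar := average h (scalar_curvature h) in
  volume_integral h (fun x => (scalar_curvature h x - Rbar) ^+ 2).

Definition traceless_ricci_energy (g : tensor_field) : R :=
  let h := main_components g in
  volume_integral h (fun x =>
    tensor_norm_sq h x (ricci h x - (scalar_curvature h x / n%:R) *: h x)).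

Definition einstein_deviation (g : tensor_field) : R :=
  let h := main_components g in
  let Rbar := average h (scalar_curvature h) in
  volume_integral h (fun x =>
    tensor_norm_sq h x (ricci h x - (Rbar / n%:R) *: h x)).

End sphere.

Arguments round_metric {R n}.

(* Main.v *)
Require Import Defs.
From mathcomp Require Import all_boot all_order all_algebra.
From mathcomp Require Import ring lra.
From mathcomp Require Import all_classical all_reals all_analysis.
From mathcomp Require Import measurable_realfun.

Set Implicit Arguments.
Unset Strict Implicit.
Unset Printing Implicit Defensive.

Import Order.TTheory GRing.Theory Num.Theory.
Import numFieldNormedType.Exports.

Local Open Scope classical_set_scope.
Local Open Scope ring_scope.

(** Put u = 1/(1+|x|^2) in stereographic coordinates. The eigenfunctions are
    zonal: f = P(u) in one chart and P(1-u) in the other, where P is the Jacobi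
    polynomial with eigenvalue lam = k(k+n-1). The round metric is 4u^2
    times the Euclidean one, and every curvature quantity of g_t is an explicit function
    of u. To first order in t,
      R - Rbar ~ t (n-1)(lam-n) f   and   Ric - (R/n) g ~ -t (n-2)/2 Hess0 f,
    with Hess0 f the traceless Hessian. Integrating by parts,
      int |Hess0 f|^2 = (n-1)/n lam (lam-n) int f^2,
    so the quotient in (i) tends to 4n(n-1)/(n-2)^2 (1 - n/lam) as t -> 0, and
    lam can be chosen as large as needed. Part (ii) reduces to (i) since
      |Ric - (Rbar/n) g|^2 = |Ric - (R/n) g|^2 + (R - Rbar)^2 / n.
    All integrals have the form int q(u) u^n dx; the integrations by parts
    amount to a recursion for the moments int u^p dx, which Fubini reduces to
    dimension one. *)

(** * Calculus of radial functions *)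

(** The chart omits one pole, at which u tends to 0, so the delicate point is uniformity near
    infinity in R^n. Written in terms of u, the scalar curvature and the size of the trace-free
    Ricci tensor are polynomial expressions divided by powers of 1 + tP, with no negative power of u
    left. Bounds on (0, 1] are therefore uniform once t is small. No limit is taken under an
    integral sign. Each curvature quantity is an exact leading term plus t times an explicit bounded
    remainder, so the integrals equal t^2 times a constant up to O(t^3), and the strict inequality
    between the two constants survives for small t. The average Rbar causes no first-order
    correction because f has mean zero. The integrals see only one chart, whereas smoothness and
    Ricci curvature are examined in both; this is why statements about P are also needed for P(1-u).
    The normalisation P(1) = 1, at the centre x = 0 of the main chart, makes f nonzero and the
    integral of f^2 positive. *)

Section chain_rule.
Context (R : realType) (V : normedModType R).
Implicit Types (f g : V -> R) (x v : V).

(** Restriction to the line through [x] in direction [v] turns directional derivatives into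
    one-variable ones, to which the one-variable chain rule applies. *)
Lemma is_derive_line f x v d :
  is_derive x v f d <-> is_derive (0 : R) 1 (fun h : R => f (h *: v + x)) d.
Proof.
have E : 'D_v f x = 'D_1 (fun h : R => f (h *: v + x)) 0.
  rewrite /derive; set g1 := fun h => h^-1 *: _; set g2 := fun h => h^-1 *: _.
  suff -> : g1 = g2 by [].
  by rewrite funeqE /g1 /g2 => h /=; rewrite addr0 scale0r add0r [_%:A]mulr1.
split=> -[df dE]; split; rewrite -?E// ?E//; first exact: (derivable1P f x v).1.
exact: (derivable1P f x v).2.
Qed.

Lemma is_derive_chain f x v d (phi : R -> R) e :
  is_derive x v f d -> is_derive (f x) 1 phi e ->
  is_derive x v (fun y => phi (f y)) (e * d).
Proof.
move=> /is_derive_line fd phie; apply/is_derive_line.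
apply: (@is_derive1_comp _ phi (fun h : R => f (h *: v + x))) => //.
by rewrite scale0r add0r.
Qed.

Lemma is_derive_fM f g x v df dg :
  is_derive x v f df -> is_derive x v g dg ->
  is_derive x v (fun y => f y * g y) (df * g x + f x * dg).
Proof.
move=> fd gd; have := is_deriveM fd gd.
by move/is_derive_eq; apply; rewrite /GRing.scale /= addrC [X in X + _]mulrC.
Qed.

Lemma is_derive_fV f x v df : f x != 0 ->
  is_derive x v f df -> is_derive x v (fun y => (f y)^-1) (- df / f x ^+ 2).
Proof.
move=> fx0 [fd <-]; apply: DeriveDef; first exact: derivableV.
by rewrite deriveV// /GRing.scale /= mulrC mulrN mulNr.
Qed.

End chain_rule.

Section coordinates.
Context (R : realType) (n : nat).
Implicit Types (x v : 'rV[R]_n).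

Lemma is_derive_coord (i : 'I_n) x v :
  is_derive x v (fun y : 'rV[R]_n => y 0 i) (v 0 i).
Proof.
apply/is_derive_line.
rewrite (_ : (fun h => _) = (fun h : R => v 0 i * h + x 0 i)); last first.
  by apply/funext => h; rewrite !mxE mulrC.
have := is_deriveD (is_deriveZ (v 0 i) (is_derive_id (0 : R) 1))
  (is_derive_cst (x 0 i) (0 : R) 1).
by rewrite addr0 /GRing.scale /= mulr1.
Qed.

(** On the sphere this is an affine function of the height p_0: (1 - p_0)/2 in the chart [false] and
    (1 + p_0)/2 in the chart [true]. Changing the chart replaces u by 1 - u. *)
Definition sphere_u x : R := (1 + dot x x)^-1.

Local Notation u := sphere_u.

Lemma dot_ge0 x : 0 <= dot x x.
Proof. by apply: sumr_ge0 => i _; rewrite -expr2 sqr_ge0. Qed.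

Lemma dot1_gt0 x : 0 < 1 + dot x x.
Proof. by rewrite ltr_pwDl// dot_ge0. Qed.

Lemma u_gt0 x : 0 < u x. Proof. by rewrite invr_gt0 dot1_gt0. Qed.

Lemma u_le1 x : u x <= 1.
Proof. by rewrite invf_le1 ?dot1_gt0// lerDl dot_ge0. Qed.

Lemma dotE x : dot x x = (1 - u x) / u x.
Proof. by rewrite /u; field; rewrite gt_eqF ?dot1_gt0// ?andbT oner_eq0. Qed.

Lemma is_derive_dot x v : is_derive x v (fun y => dot y y) (2 * dot x v).
Proof.
have -> : (fun y : 'rV[R]_n => dot y y) = \sum_(i < n) (fun y : 'rV[R]_n => y 0 i * y 0 i).
  by apply/funext => y; rewrite fct_sumE.
have := @is_derive_sum R _ _ n (fun i (y : 'rV[R]_n) => y 0 i * y 0 i) x v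
  (fun i => v 0 i * x 0 i + x 0 i * v 0 i)
  (fun i => is_derive_fM (is_derive_coord i x v) (is_derive_coord i x v)).
by move/is_derive_eq; apply; rewrite /dot mulr_sumr; apply: eq_bigr => i _; ring.
Qed.

Lemma dot_delta x i : dot x (delta_mx 0 i) = x 0 i.
Proof.
rewrite /dot (bigD1 i)//= mxE !eqxx mulr1 big1 ?addr0// => j ji.
by rewrite mxE (negbTE ji) mulr0.
Qed.

Lemma is_derive_u x v : is_derive x v u (- 2 * u x ^+ 2 * dot x v).
Proof.
have d1 : is_derive x v (fun y => 1 + dot y y) (2 * dot x v).
  have := is_deriveD (is_derive_cst (1 : R) x v) (is_derive_dot x v).
  by rewrite add0r.
have := @is_derive_fV R _ (fun y => 1 + dot y y) x v _ (lt0r_neq0 (dot1_gt0 x)) d1.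
move/is_derive_eq; apply; rewrite /u; field.
by rewrite gt_eqF// dot1_gt0.
Qed.

Lemma is_derive_radial x v (phi : R -> R) d : is_derive (u x) 1 phi d ->
  is_derive x v (fun y => phi (u y)) (- 2 * u x ^+ 2 * d * dot x v).
Proof.
move=> phid; have := is_derive_chain (is_derive_u x v) phid.
by move/is_derive_eq; apply; ring.
Qed.

Lemma is_derive_partial f x i d :
  is_derive x (delta_mx 0 i) f d -> partial i f x = d.
Proof. by move=> fd; rewrite /partial derive_val. Qed.

Lemma partial_radial x i (phi : R -> R) d : is_derive (u x) 1 phi d ->
  partial i (fun y => phi (u y)) x = - 2 * u x ^+ 2 * d * x 0 i.
Proof.
by move=> phid; rewrite (is_derive_partial (is_derive_radial _ phid)) dot_delta.
Qed.

Lemma is_derive_coord_radial x i k (phi : R -> R) d : is_derive (u x) 1 phi d ->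
  is_derive x (delta_mx 0 i) (fun y => y 0 k * phi (u y))
    ((k == i)%:R * phi (u x) - 2 * u x ^+ 2 * d * x 0 i * x 0 k).
Proof.
move=> phid.
have := is_derive_fM (is_derive_coord k x (delta_mx 0 i))
  (is_derive_radial (delta_mx 0 i) phid).
move/is_derive_eq; apply; rewrite dot_delta mxE eqxx /=; ring.
Qed.

End coordinates.

(** * Continuity and smoothness in coordinates *)

Section pointwise_continuity.
Context (R : realType) (T : topologicalType).
Implicit Types f g : T -> R.

Lemma continuous_fD f g : continuous f -> continuous g ->
  continuous (fun x => f x + g x).
Proof. by move=> cf cg x; apply: cvgD; [exact: cf|exact: cg]. Qed.

Lemma continuous_fM f g : continuous f -> continuous g ->
  continuous (fun x => f x * g x).
Proof. by move=> cf cg x; apply: cvgM; [exact: cf|exact: cg]. Qed.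

Lemma continuous_fV f : (forall x, f x != 0) -> continuous f ->
  continuous (fun x => (f x)^-1).
Proof. by move=> f0 cf x; apply: cvgV; [exact: f0|exact: cf]. Qed.

End pointwise_continuity.

Section smoothness.
Context (R : realType) (n : nat).
Implicit Types (f g : 'rV[R]_n -> R) (k : nat).

Lemma is_CkS k f : is_Ck k.+1 f -> is_Ck k f.
Proof.
elim: k f => [|k IH] f [cf Hf]; first by split.
by split=> // i; have [df Cf] := Hf i; split=> //; exact: IH.
Qed.

Lemma is_Ck_step k f (df : 'I_n -> 'rV[R]_n -> R) : continuous f ->
  (forall i x, is_derive x (delta_mx 0 i) f (df i x)) ->
  (forall i, is_Ck k (df i)) -> is_Ck k.+1 f.
Proof.
move=> cf fd Cdf; split=> // i; split; first by move=> x; have [] := fd i x.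
rewrite (_ : partial i f = df i)//; apply/funext => x.
exact: (is_derive_partial (fd i x)).
Qed.

Lemma is_Ck_derivable k f i x : is_Ck k.+1 f ->
  is_derive x (delta_mx 0 i) f (partial i f x).
Proof. by move=> [_ /(_ i)[fd _]]; split. Qed.

Lemma is_Ck_cst k (a : R) : is_Ck k (fun _ : 'rV[R]_n => a).
Proof.
elim: k a => [|k IH] a; first by split=> //; exact: cst_continuous.
apply: (@is_Ck_step _ _ (fun _ _ => 0)) => //; exact: cst_continuous.
Qed.

Lemma is_CkD k f g : is_Ck k f -> is_Ck k g -> is_Ck k (fun x => f x + g x).
Proof.
elim: k f g => [|k IH] f g Cf Cg.
  by split=> //; apply: continuous_fD; [exact: Cf.1|exact: Cg.1].
apply: (@is_Ck_step _ _ (fun i x => partial i f x + partial i g x)).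
- by apply: continuous_fD; [exact: Cf.1|exact: Cg.1].
- by move=> i x; exact: (is_deriveD (is_Ck_derivable i x Cf) (is_Ck_derivable i x Cg)).
- by move=> i; apply: IH; [exact: (Cf.2 i).2|exact: (Cg.2 i).2].
Qed.

Lemma is_CkM k f g : is_Ck k f -> is_Ck k g -> is_Ck k (fun x => f x * g x).
Proof.
elim: k f g => [|k IH] f g Cf Cg.
  by split=> //; apply: continuous_fM; [exact: Cf.1|exact: Cg.1].
apply: (@is_Ck_step _ _ (fun i x => partial i f x * g x + f x * partial i g x)).
- by apply: continuous_fM; [exact: Cf.1|exact: Cg.1].
- by move=> i x; exact: (is_derive_fM (is_Ck_derivable i x Cf) (is_Ck_derivable i x Cg)).
- by move=> i; apply: is_CkD; apply: IH;
    [exact: (Cf.2 i).2|exact: is_CkS|exact: is_CkS|exact: (Cg.2 i).2].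
Qed.

Lemma is_Ck_coord k (j : 'I_n) : is_Ck k (fun x : 'rV[R]_n => x 0 j).
Proof.
case: k => [|k]; first by split=> //; exact: coord_continuous.
apply: (@is_Ck_step _ _ (fun i _ => delta_mx 0 i 0 j)).
- exact: coord_continuous.
- by move=> i x; exact: is_derive_coord.
- by move=> i; exact: is_Ck_cst.
Qed.

Lemma continuous_u : continuous (@sphere_u R n).
Proof.
apply: continuous_fV => [x|]; first exact/lt0r_neq0/dot1_gt0.
apply: continuous_fD; first exact: cst_continuous.
have : is_Ck 0 (fun y : 'rV[R]_n => dot y y).
  rewrite (_ : (fun y => _) = \sum_(i < n) (fun y : 'rV[R]_n => y 0 i * y 0 i)).
    elim/big_ind : _ => [|f g|i _]; [exact: is_Ck_cst|exact: is_CkD|].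
    by apply: is_CkM; exact: is_Ck_coord.
  by apply/funext => y; rewrite fct_sumE.
by case.
Qed.

(** The partial derivatives -2 u^2 x_i are again polynomial in u and the coordinates, so the
    induction on k closes. *)
Lemma is_Ck_u k : is_Ck k (@sphere_u R n).
Proof.
elim: k => [|k IH]; first by split=> //; exact: continuous_u.
apply: (@is_Ck_step _ _
  (fun i x => - 2 * (sphere_u x * sphere_u x) * x 0 i)).
- exact: continuous_u.
- by move=> i x; have := is_derive_u x (delta_mx 0 i); rewrite dot_delta expr2.
- move=> i; apply: is_CkM; last exact: is_Ck_coord.
  by apply: is_CkM; [exact: is_Ck_cst|exact: is_CkM].
Qed.

Lemma is_smooth_poly_u (p : {poly R}) :
  is_smooth (fun x : 'rV[R]_n => p.[sphere_u x]).
Proof.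
move=> k; elim/poly_ind : p => [|p c IH].
  by under eq_fun do rewrite horner0; exact: is_Ck_cst.
under eq_fun do rewrite hornerMXaddC.
by apply: is_CkD; [apply: is_CkM => //; exact: is_Ck_u|exact: is_Ck_cst].
Qed.

End smoothness.

(** * Curvature of radial conformally flat metrics *)

Section delta_sums.
Context (R : comPzRingType) (n : nat).

Definition kron (i j : 'I_n) : R := (i == j)%:R.

Lemma kronC i j : kron i j = kron j i. Proof. by rewrite /kron eq_sym. Qed.

Lemma kronii i : kron i i = 1. Proof. by rewrite /kron eqxx. Qed.

Lemma sum_kron i (F : 'I_n -> R) : \sum_j kron i j * F j = F i.
Proof.
rewrite (bigD1 i)//= kronii mul1r big1 ?addr0// => j ji.
by rewrite /kron eq_sym (negbTE ji) mul0r.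
Qed.

Lemma sum_const (a : R) : \sum_(i < n) a = n%:R * a.
Proof. by rewrite sumr_const card_ord mulr_natl. Qed.

End delta_sums.
Arguments kron {R n}.
Arguments kronC {R n}.
Arguments kronii {R n}.

Section radial_metric.
Context (R : realType) (n : nat) (F : {poly R}).
Hypothesis F_gt0 : forall v, 0 < v -> v <= 1 -> 0 < F.[v].
Local Notation u := (@sphere_u R n).
Implicit Types (x : 'rV[R]_n).

Definition radial_metric x : 'M[R]_n := (F.[u x])%:M.

Local Notation h := radial_metric.

(* Gamma^k_ij = chr(u) (delta_kj x_i + delta_ki x_j - delta_ij x_k). *)
Definition chr (v : R) : R := - v ^+ 2 * F^`().[v] / F.[v].

Definition dchr (v : R) : R :=
  - (2 * v * F^`().[v] + v ^+ 2 * F^`()^`().[v]) / F.[v]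
  + v ^+ 2 * F^`().[v] ^+ 2 / F.[v] ^+ 2.

Lemma F_u_neq0 x : F.[u x] != 0.
Proof. by rewrite gt_eqF// F_gt0 ?u_gt0 ?u_le1. Qed.

Lemma is_derive_chr v : F.[v] != 0 -> is_derive v 1 chr (dchr v).
Proof.
move=> Fv0.
have d1 := @is_derive_poly R (- 'X^2 * F^`()) v.
have d2 := @is_derive_fV R _ (horner F) v 1 _ Fv0 (is_derive_poly F v).
have := is_derive_fM d1 d2.
rewrite (_ : (fun y => _) = chr); last first.
  by apply/funext => y; rewrite /chr !hornerE.
move/is_derive_eq; apply; rewrite /dchr derivM derivN derivXn !hornerE /=; field.
exact: Fv0.
Qed.

Lemma metric_invE x i j : metric_inv h x i j = kron i j * F.[u x]^-1.
Proof.
by rewrite /metric_inv /h invmx_scalar mxE /kron mulr_natl.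
Qed.

Lemma partial_metric x i j l :
  partial i (fun y => h y j l) x =
  kron j l * (- 2 * u x ^+ 2 * F^`().[u x] * x 0 i).
Proof.
rewrite (_ : (fun y => h y j l) = (fun y => (kron j l *: F).[u y])); last first.
  by apply/funext => y; rewrite /h mxE hornerZ /kron mulr_natl.
apply: etrans; first exact: (partial_radial i (is_derive_poly (kron j l *: F) (u x))).
by rewrite derivZ hornerZ; ring.
Qed.

Lemma christoffelE k i j x : christoffel h k i j x =
  chr (u x) * (kron k j * x 0 i + kron k i * x 0 j - kron i j * x 0 k).
Proof.
rewrite /christoffel.
under eq_bigr => l _ do rewrite metric_invE -mulrA !partial_metric.
rewrite sum_kron /chr (kronC j k) (kronC i k); field; exact: F_u_neq0.
Qed.

(* d_i (x_j chr(u)) *)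
Definition dchr_mx x i j : R :=
  kron i j * chr (u x) - 2 * u x ^+ 2 * dchr (u x) * x 0 i * x 0 j.

Lemma is_derive_coord_chr m i x :
  is_derive x (delta_mx 0 m) (fun y => y 0 i * chr (u y)) (dchr_mx x m i).
Proof.
have := is_derive_coord_radial m i (is_derive_chr (F_u_neq0 x)).
by move/is_derive_eq; apply; rewrite /dchr_mx kronC.
Qed.

Lemma partial_christoffel m k i j x : partial m (christoffel h k i j) x =
  kron k j * dchr_mx x m i + kron k i * dchr_mx x m j - kron i j * dchr_mx x m k.
Proof.
have Ec c a : is_derive x (delta_mx 0 m)
    (fun y : 'rV[R]_n => c * (y 0 a * chr (u y))) (c * dchr_mx x m a).
  have := is_derive_fM (is_derive_cst c x (delta_mx 0 m)) (is_derive_coord_chr m a x).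
  by move/is_derive_eq; apply; rewrite mul0r add0r.
apply: is_derive_partial.
have -> : christoffel h k i j = (fun y : 'rV[R]_n =>
   kron k j * (y 0 i * chr (u y)) + kron k i * (y 0 j * chr (u y))
   - kron i j * (y 0 k * chr (u y))).
  by apply/funext => y; rewrite christoffelE; ring.
exact: (is_deriveB (is_deriveD (Ec _ _) (Ec _ _)) (Ec _ _)).
Qed.

(** The trace of [riemann] splits into four sums, two of derivatives and two of products of
    Christoffel symbols. Each summand is brought to the form of Kronecker deltas times a factor,
    plus a multiple of a squared coordinate; [sum_kron] collapses the former and the latter add up
    to |x|^2. *)
Lemma ricciE x i j : ricci h x i j =
  kron i j * (- (2 * n%:R - 2) * chr (u x)
    + 2 * dot x x * u x ^+ 2 * dchr (u x)
    - (n%:R - 2) * dot x x * chr (u x) ^+ 2)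
  + (n%:R - 2) * (2 * u x ^+ 2 * dchr (u x) + chr (u x) ^+ 2)
    * x 0 i * x 0 j.
Proof.
rewrite mxE /riemann; set k := i.
have s1 : \sum_l partial l (christoffel h l j k) x =
    2 * dchr_mx x j k - kron j k *
      (n%:R * chr (u x) - 2 * u x ^+ 2 * dchr (u x) * dot x x).
  under eq_bigr => l _ do rewrite partial_christoffel kronC (kronC l j) -addrA.
  rewrite big_split /= sum_kron big_split /= sum_kron sumrN -mulr_sumr.
  have -> : \sum_l dchr_mx x l l =
      n%:R * chr (u x) - 2 * u x ^+ 2 * dchr (u x) * dot x x.
    rewrite /dchr_mx sumrB.
    under eq_bigr do rewrite kronii mul1r.
    rewrite sum_const /dot mulr_sumr; congr (_ - _).
    by apply: eq_bigr => l _; ring.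
  by rewrite {1}/dchr_mx kronC /dchr_mx; ring.
have s2 : \sum_l partial j (christoffel h l l k) x = n%:R * dchr_mx x j k.
  under eq_bigr => l _ do rewrite partial_christoffel kronii mul1r addrAC subrr add0r.
  by rewrite sum_const.
have s3 : \sum_l \sum_m christoffel h l l m x * christoffel h m j k x =
    n%:R * chr (u x) ^+ 2 * (2 * x 0 j * x 0 k - kron j k * dot x x).
  have e l m : christoffel h l l m x * christoffel h m j k x =
      kron k m * (chr (u x) ^+ 2 * x 0 j * x 0 m)
        + (kron j m * (chr (u x) ^+ 2 * x 0 k * x 0 m)
        + - (chr (u x) ^+ 2 * kron j k) * (x 0 m * x 0 m)).
    by rewrite !christoffelE kronii (kronC k m) (kronC j m); ring.
  have e' l : \sum_m christoffel h l l m x * christoffel h m j k x =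
      chr (u x) ^+ 2 * (2 * x 0 j * x 0 k - kron j k * dot x x).
    under eq_bigr do rewrite e.
    by rewrite !big_split /= !sum_kron -mulr_sumr -/(dot x x); ring.
  under eq_bigr do rewrite e'.
  by rewrite sum_const mulrA.
have s4 : \sum_l \sum_m christoffel h l j m x * christoffel h m l k x =
    chr (u x) ^+ 2 * ((n%:R + 2) * x 0 j * x 0 k - 2 * kron j k * dot x x).
  have e l m : christoffel h l j m x * christoffel h m l k x =
      kron l m * (chr (u x) ^+ 2 * x 0 j *
          (kron m k * x 0 l + kron m l * x 0 k - kron l k * x 0 m))
      + (kron j m * (- chr (u x) ^+ 2 * x 0 l *
          (kron m k * x 0 l + kron m l * x 0 k - kron l k * x 0 m))
      + (kron k m * (chr (u x) ^+ 2 * kron l j * x 0 m * x 0 l)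
      + (kron l m * (chr (u x) ^+ 2 * kron l j * x 0 m * x 0 k)
      + - (chr (u x) ^+ 2 * kron l j * kron l k) * (x 0 m * x 0 m)))).
    by rewrite !christoffelE (kronC k m) (kronC m l); ring.
  have e' l : \sum_m christoffel h l j m x * christoffel h m l k x =
      chr (u x) ^+ 2 * x 0 j * x 0 k
      + (- (chr (u x) ^+ 2 * kron j k) * (x 0 l * x 0 l)
      + (kron k l * (chr (u x) ^+ 2 * x 0 j * x 0 l)
      + kron j l * (chr (u x) ^+ 2 *
         (x 0 l * x 0 k - kron l k * dot x x)))).
    under eq_bigr do rewrite e.
    rewrite !big_split /= !sum_kron -mulr_sumr -/(dot x x) kronii.
    by rewrite (kronC l j) (kronC k l); ring.
  under eq_bigr do rewrite e'.
  by rewrite !big_split /= sum_const -mulr_sumr -/(dot x x) !sum_kron; ring.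
under eq_bigr do rewrite sumrB.
rewrite big_split /= !sumrB.
transitivity (2 * dchr_mx x j k - kron j k *
    (n%:R * chr (u x) - 2 * u x ^+ 2 * dchr (u x) * dot x x)
  - n%:R * dchr_mx x j k
  + (n%:R * chr (u x) ^+ 2 * (2 * x 0 j * x 0 k - kron j k * dot x x)
  - chr (u x) ^+ 2 * ((n%:R + 2) * x 0 j * x 0 k - 2 * kron j k * dot x x))).
  by congr (_ - _ + (_ - _)).
by rewrite /dchr_mx (kronC j k); ring.
Qed.

End radial_metric.

Section radial_curvature.
Context (R : realType) (n : nat) (F : {poly R}).
Hypothesis F_gt0 : forall v, 0 < v -> v <= 1 -> 0 < F.[v].
Local Notation u := (@sphere_u R n).
Local Notation h := (@radial_metric R n F).
Implicit Types (x : 'rV[R]_n).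

(* Ric_ij = ric_iso(u) delta_ij + ric_rad(u) x_i x_j; note |x|^2 = (1-u)/u. *)
Definition ric_iso (v : R) : R :=
  - (2 * n%:R - 2) * chr F v + 2 * v * (1 - v) * dchr F v
  - (n%:R - 2) * ((1 - v) / v) * chr F v ^+ 2.

Definition ric_rad (v : R) : R :=
  (n%:R - 2) * (2 * v ^+ 2 * dchr F v + chr F v ^+ 2).

Lemma ricci_radial x i j : ricci h x i j =
  kron i j * ric_iso (u x) + ric_rad (u x) * (x 0 i * x 0 j).
Proof.
rewrite ricciE// dotE /ric_iso /ric_rad mulrA; congr (_ * _ + _).
  by field; rewrite gt_eqF// u_gt0.
by rewrite mulrA.
Qed.

Definition scal (v : R) : R :=
  (n%:R * ric_iso v + ric_rad v * ((1 - v) / v)) / F.[v].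

Lemma metric_trace_radial x (T : 'M[R]_n) :
  metric_trace h x T = (\sum_i T i i) / F.[u x].
Proof.
rewrite /metric_trace mulr_suml; apply: eq_bigr => i _.
by under eq_bigr => j _ do rewrite metric_invE// -mulrA; rewrite sum_kron mulrC.
Qed.

Lemma scalar_curvature_radial x : scalar_curvature h x = scal (u x).
Proof.
rewrite /scalar_curvature metric_trace_radial /scal; congr (_ / _).
under eq_bigr => i _ do rewrite ricci_radial kronii mul1r.
by rewrite big_split /= sum_const -mulr_sumr -/(dot x x) dotE.
Qed.

Lemma tensor_norm_sq_radial x (T : 'M[R]_n) :
  tensor_norm_sq h x T = (\sum_i \sum_j T i j ^+ 2) / F.[u x] ^+ 2.
Proof.
rewrite /tensor_norm_sq mulr_suml; apply: eq_bigr => i _.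
rewrite mulr_suml; apply: eq_bigr => j _.
have e k l : metric_inv h x i k * metric_inv h x j l * T i j * T k l =
    kron j l * (kron i k * (T i j * T k l / F.[u x] ^+ 2)).
  by rewrite !metric_invE//; field; exact: F_u_neq0.
under eq_bigr do (under eq_bigr do rewrite e; rewrite sum_kron).
by rewrite sum_kron expr2.
Qed.

(** Orthogonal splitting: the tensor is the trace-free part, [ric_rad] times (x_i x_j - |x|^2
    delta_ij / n), plus (scal - c)/n times h. Their squared norms are the two summands, since |x_i
    x_j - |x|^2 delta_ij / n|^2 = (1 - 1/n) |x|^4 in the Euclidean norm. Taking c to be the scalar
    curvature or its average gives the two Ricci energies. *)
Lemma norm_sq_ricci_sub x (c : R) : (0 < n)%N ->
  tensor_norm_sq h x (ricci h x - (c / n%:R) *: h x) =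
  (1 - n%:R^-1) * (ric_rad (u x) * ((1 - u x) / u x) / F.[u x]) ^+ 2
  + (scal (u x) - c) ^+ 2 / n%:R.
Proof.
move=> n_gt0; rewrite tensor_norm_sq_radial.
set a := ric_iso (u x) - c / n%:R * F.[u x].
have e i j : (ricci h x - (c / n%:R) *: h x) i j ^+ 2 =
    kron i j * (a ^+ 2 + 2 * a * ric_rad (u x) * (x 0 i * x 0 j))
    + ric_rad (u x) ^+ 2 * (x 0 i * x 0 i) * (x 0 j * x 0 j).
  have -> : (ricci h x - (c / n%:R) *: h x) i j =
      kron i j * a + ric_rad (u x) * (x 0 i * x 0 j).
    have eF : F.[u x] *+ (i == j) = kron i j * F.[u x] by rewrite /kron mulr_natl.
    by rewrite mxE ricci_radial /a !mxE eF; ring.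
  have -> : kron i j = kron i j ^+ 2 :> R.
    by rewrite /kron; case: (i == j); rewrite ?expr1n ?expr0n.
  rewrite sqrrD; congr (_ + _); last by ring.
  rewrite /kron; case: (i == j); rewrite ?expr1n ?expr0n /=; ring.
have e' i : \sum_j (ricci h x - (c / n%:R) *: h x) i j ^+ 2 =
    a ^+ 2 + (2 * a * ric_rad (u x) + ric_rad (u x) ^+ 2 * dot x x)
      * (x 0 i * x 0 i).
  under eq_bigr do rewrite e.
  by rewrite big_split /= sum_kron -mulr_sumr -/(dot x x); ring.
under eq_bigr do rewrite e'.
rewrite big_split /= sum_const -mulr_sumr -/(dot x x) /scal /a dotE.
have n0 : n%:R != 0 :> R by rewrite pnatr_eq0 -lt0n.
have u0 : u x != 0 by rewrite gt_eqF// u_gt0.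
have := F_u_neq0 F_gt0 x; move: (F.[u x]) (ric_iso _) (ric_rad _) => f b r f0.
by field; rewrite f0 u0 n0.
Qed.

Lemma laplacian_radial x (P : {poly R}) :
  laplacian h (fun y => P.[u y]) x =
  (- 2 * n%:R * u x ^+ 2 * P^`().[u x]
   + 4 * u x * (1 - u x) * (2 * u x * P^`().[u x] + u x ^+ 2 * P^`()^`().[u x])
   - 2 * (n%:R - 2) * u x * (1 - u x) * chr F (u x) * P^`().[u x]) / F.[u x].
Proof.
rewrite /laplacian metric_trace_radial; congr (_ / _).
(* The k-th partial derivative of P(u) is x_k [psi](u), a coordinate times a radial polynomial, so
   [is_derive_coord_radial] applies a second time. *)
set psi := (- 2)%:P * 'X^2 * P^`() : {poly R}.
have d1 k : partial k (fun y => P.[u y]) = (fun y => y 0 k * psi.[u y]).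
  apply/funext => y; have := partial_radial k (is_derive_poly P (u y)).
  by move=> ->; rewrite /psi !(hornerM, hornerC, hornerX); ring.
have d2 i j : partial i (partial j (fun y => P.[u y])) x =
    kron j i * psi.[u x] - 2 * u x ^+ 2 * psi^`().[u x] * (x 0 i * x 0 j).
  rewrite d1 mulrA; apply: is_derive_partial.
  exact: is_derive_coord_radial (is_derive_poly _ _).
have e i : (\matrix_(i0, j) (partial i0 (partial j (fun y => P.[u y])) x -
    \sum_k christoffel h k i0 j x * partial k (fun y => P.[u y]) x)) i i =
    psi.[u x] + chr F (u x) * psi.[u x] * dot x x
    + (- 2 * u x ^+ 2 * psi^`().[u x] - 2 * chr F (u x) * psi.[u x])
      * (x 0 i * x 0 i).
  rewrite mxE d2 kronii mul1r.
  have e k : christoffel h k i i x * partial k (fun y => P.[u y]) x =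
     kron i k * (2 * chr F (u x) * psi.[u x] * x 0 i * x 0 k)
     + - (chr F (u x) * psi.[u x]) * (x 0 k * x 0 k).
    by rewrite christoffelE// d1 kronii (kronC k i); ring.
  under eq_bigr do rewrite e.
  by rewrite big_split /= sum_kron -mulr_sumr -/(dot x x); ring.
under eq_bigr do rewrite e.
rewrite big_split /= sum_const -mulr_sumr -/(dot x x) dotE.
have u0 : u x != 0 by rewrite gt_eqF// u_gt0.
move: (chr F (u x)) => A.
rewrite /psi !(derivM, derivC, derivX) !hornerE /=.
by field.
Qed.

Lemma det_radial x : \det (h x) = F.[u x] ^+ n.
Proof. by rewrite /radial_metric det_scalar. Qed.

End radial_curvature.

(** * Curvature of (1 + tP) times the round metric *)

Section conformal_curvature.
Context (R : realType) (n : nat) (P : {poly R}) (t : R).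
Implicit Types v : R.

(** Its value at u is the conformal factor of g_t over the Euclidean metric; P = 0 and t = 0 give
    the round metric. *)
Definition conf_poly : {poly R} := (4%:P * 'X^2) * (1 + t *: P).

Local Notation F := conf_poly.
Local Notation D v := (1 + t * P.[v]).

Lemma conf_polyE v : F.[v] = 4 * v ^+ 2 * D v.
Proof. by rewrite /F !hornerE /=; ring. Qed.

Lemma conf_poly_deriv v : F^`().[v] = 8 * v * D v + 4 * v ^+ 2 * (t * P^`().[v]).
Proof.
rewrite /F !(derivM, derivD, derivZ, derivC, derivX) !hornerE /=; ring.
Qed.

Lemma conf_poly_deriv2 v : F^`()^`().[v] =
  8 * D v + 16 * v * (t * P^`().[v]) + 4 * v ^+ 2 * (t * P^`()^`().[v]).
Proof.
rewrite /F !(derivM, derivD, derivZ, derivC, derivX, deriv0) !hornerE /=; ring.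
Qed.

(* [qlog] and [dqlog] are the first two derivatives of ln (1 + t P). *)
Definition qlog v : R := t * P^`().[v] / D v.
Definition dqlog v : R := t * P^`()^`().[v] / D v - qlog v ^+ 2.

Lemma conf_chr v : v != 0 -> D v != 0 -> chr F v = - 2 * v - v ^+ 2 * qlog v.
Proof.
move=> v0 D0; rewrite /chr conf_polyE conf_poly_deriv /qlog; field.
by rewrite D0 v0.
Qed.

Lemma conf_dchr v : v != 0 -> D v != 0 ->
  dchr F v = - 2 - 2 * v * qlog v - v ^+ 2 * dqlog v.
Proof.
move=> v0 D0.
rewrite /dchr conf_polyE conf_poly_deriv conf_poly_deriv2 /dqlog /qlog; field.
by rewrite D0 v0.
Qed.

Lemma conf_ric_iso v : v != 0 -> D v != 0 ->
  ric_iso n F v = v ^+ 2 * (4 * (n%:R - 1) + 2 * (n%:R - 1) * (2 * v - 1) * qlog v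
   - 2 * v * (1 - v) * dqlog v - (n%:R - 2) * v * (1 - v) * qlog v ^+ 2).
Proof.
move=> v0 D0; rewrite /ric_iso conf_chr// conf_dchr//.
by move: (qlog v) (dqlog v) => q1 q2; field.
Qed.

Lemma conf_ric_rad v : v != 0 -> D v != 0 ->
  ric_rad n F v = (n%:R - 2) * v ^+ 4 * (qlog v ^+ 2 - 2 * dqlog v).
Proof.
move=> v0 D0; rewrite /ric_rad conf_chr// conf_dchr//.
by move: (qlog v) (dqlog v) => q1 q2; ring.
Qed.

(** All negative powers of v cancel: the growth of |x|^2 and of 1/F towards the omitted pole is
    absorbed by the factor v^4 of [ric_rad]. This is what makes bounds uniform on (0, 1]. *)
Lemma conf_traceless v : v != 0 -> D v != 0 ->
  ric_rad n F v * ((1 - v) / v) / F.[v] =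
  (n%:R - 2) / 4 * (v * (1 - v)) * (qlog v ^+ 2 - 2 * dqlog v) / D v.
Proof.
move=> v0 D0; rewrite conf_ric_rad// conf_polyE.
by move: (qlog v) (dqlog v) => q1 q2; field; rewrite D0 v0.
Qed.

Lemma conf_scal v : v != 0 -> D v != 0 ->
  scal n F v = (n%:R - 1) / 4 * (4 * n%:R + 2 * n%:R * (2 * v - 1) * qlog v
   - 4 * v * (1 - v) * dqlog v - (n%:R - 2) * v * (1 - v) * qlog v ^+ 2) / D v.
Proof.
move=> v0 D0; rewrite /scal conf_ric_rad// conf_ric_iso// conf_polyE.
by move: (qlog v) (dqlog v) => q1 q2; field; rewrite D0 v0.
Qed.

(* -Delta f = lam f for f = P(u) on the round sphere. *)
Definition jacobi (lam : R) := forall v,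
  v * (1 - v) * P^`()^`().[v] + n%:R / 2 * (1 - 2 * v) * P^`().[v] = - lam * P.[v].

(** The exact remainder of order t^2 of the scalar curvature, for every t. The second derivative of
    P has been eliminated by the eigenvalue equation, and only powers of 1 + tP are left as
    denominators. *)
Definition scal_rem (lam : R) v : R := (n%:R - 1) *
  (n%:R * P.[v] ^+ 2 / D v - lam * P.[v] ^+ 2 * (2 + t * P.[v]) / D v ^+ 2
   + (6 - n%:R) / 4 * v * (1 - v) * P^`().[v] ^+ 2 / D v ^+ 3).

Lemma conf_scal_expansion lam v : jacobi lam -> v != 0 -> D v != 0 ->
  scal n F v = n%:R * (n%:R - 1) + t * (n%:R - 1) * (lam - n%:R) * P.[v]
    + t ^+ 2 * scal_rem lam v.
Proof.
move=> /(_ v) J v0 D0; rewrite conf_scal// /scal_rem /dqlog /qlog.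
(* [lam] is made to occur only in the product lam P, which the equation then replaces by derivatives
   of P. *)
have -> : lam * P.[v] ^+ 2 = P.[v] * (lam * P.[v]) by ring.
have -> : t * (n%:R - 1) * (lam - n%:R) * P.[v] =
  t * (n%:R - 1) * (lam * P.[v] - n%:R * P.[v]) by ring.
have -> : lam * P.[v] = -
  (v * (1 - v) * P^`()^`().[v] + n%:R / 2 * (1 - 2 * v) * P^`().[v]).
  by rewrite J; ring.
by move: D0; move: (P.[v]) (P^`().[v]) (P^`()^`().[v]) => p p1 p2 D0; field.
Qed.

End conformal_curvature.

Lemma laplacian_round (R : realType) n (P : {poly R}) (x : 'rV[R]_n) :
  let v := sphere_u x in
  laplacian (radial_metric (conf_poly 0 0)) (fun y => P.[sphere_u y]) x =
  v * (1 - v) * P^`()^`().[v] + n%:R / 2 * (1 - 2 * v) * P^`().[v].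
Proof.
move=> v; have v0 : v != 0 by rewrite gt_eqF// u_gt0.
have D0 w : 1 + 0 * (0 : {poly R}).[w] != 0 by rewrite mul0r addr0 oner_eq0.
rewrite laplacian_radial => [|w w0 _]; last first.
  by rewrite conf_polyE mul0r addr0 mulr1 mulr_gt0// exprn_gt0.
rewrite -/v conf_chr// conf_polyE /qlog !mul0r addr0; field.
exact: v0.
Qed.

(** * Zonal eigenfunctions *)

Section jacobi_polynomial.
Context (R : realType) (n : nat).
Hypothesis n_gt0 : (0 < n)%N.

(* Power series solution at u = 0; it terminates when lam = k(k+n-1). *)
Fixpoint jacobi_coef (lam : R) (j : nat) : R :=
  if j is i.+1 then
    jacobi_coef lam i * ((i%:R * (i%:R + n%:R - 1) - lam)
      / ((i%:R + 1) * (i%:R + n%:R / 2)))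
  else 1.

(** The equation is invariant under v -> 1 - v, the reflection of the sphere that exchanges the two
    charts. *)
Lemma jacobi_comp (P : {poly R}) lam : jacobi n P lam ->
  jacobi n (P \Po (1 - 'X)) lam.
Proof.
move=> J v; have := J (1 - v).
rewrite !(deriv_comp, derivM, derivB, derivX, derivC) sub0r.
rewrite !(hornerE, horner_comp) /= => H; rewrite -H; ring.
Qed.

(** The series solution Q takes the value 1 at 0. Reflecting it moves this normalisation to u = 1,
    the centre of the chart [false]. *)
Lemma jacobi_exists (k : nat) : exists P : {poly R},
  jacobi n P (k%:R * (k%:R + n%:R - 1)) /\ P.[1] = 1.
Proof.
set lam := k%:R * (k%:R + n%:R - 1).
pose c := jacobi_coef lam.
(* The numerator i(i+n-1) - lam of the recurrence vanishes at i = k, which kills the coefficient of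
   index k + 1 and all later ones. *)
have c0 i : (k < i)%N -> c i = 0.
  elim: i => // i IH; rewrite ltnS leq_eqVlt => /predU1P[<-|/IH /= ci].
    by rewrite /c /= subrr mul0r mulr0.
  by rewrite /c /= -/(c i) ci mul0r.
pose Q := \poly_(i < k.+1) c i.
have Qc i : Q`_i = c i by rewrite coef_poly; case: ltnP => // /c0 ->.
have rec i : (i.+1)%:R * (i%:R + n%:R / 2) * c i.+1 =
    (i%:R * (i%:R + n%:R - 1) - lam) * c i.
  rewrite /c /= -/(c i) -natr1; field.
  by rewrite natr1 -natrM -natrD !pnatr_eq0 andbT -lt0n addn_gt0 n_gt0 orbT.
have c00 : c 0 = 1 by [].
clearbody Q c => {c0}.
have Q_jacobi : jacobi n Q lam.
  have eq_of_sub (a b a' b' : R) : a = b -> a' - b' = a - b -> a' = b'.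
    by move=> -> /eqP; rewrite subrr subr_eq0 => /eqP.
  have E : 'X * (Q^`()^`() - 'X * Q^`()^`())
      + (n%:R / 2) *: (Q^`() - 2 *: ('X * Q^`())) = - lam *: Q.
    apply/polyP => i; rewrite !(coefD, coefB, coefN, coefZ, coefXM, coef_deriv, Qc).
    case: i => [|[|i]] /=.
    - by apply: eq_of_sub (rec 0%N) _; field.
    - by apply: eq_of_sub (rec 1%N) _; field.
    - by apply: eq_of_sub (rec i.+2) _; field.
  move=> v; have := congr1 (horner^~ v) E.
  by rewrite !hornerE /= => <-; field.
exists (Q \Po (1 - 'X)); split; first exact: jacobi_comp.
by rewrite horner_comp !hornerE /= subrr horner_coef0 Qc.
Qed.

End jacobi_polynomial.

(** * Metrics in the stereographic charts *)

Section stereographic.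
Context (R : realType) (n : nat).
Local Notation u := (@sphere_u R n).
Implicit Types (x : 'rV[R]_n) (b : bool).

Lemma stereo_pole b x : stereo b x 0 (lshift n 0) = (-1) ^+ b * (1 - 2 * u x).
Proof.
rewrite /stereo row_mxEl mxE eqxx mulr1n; congr (_ * _).
by rewrite /u; field; rewrite gt_eqF// dot1_gt0.
Qed.

Lemma stereo_rest b x k : stereo b x 0 (rshift 1 k) = 2 * (x 0 k * u x).
Proof. by rewrite /stereo row_mxEr mxE /u; ring. Qed.

Definition dstereo b x i : 'rV[R]_(1 + n) :=
  row_mx (((-1) ^+ b * (4 * u x ^+ 2 * x 0 i))%:M)
    (\row_k (2 * (kron k i * u x - 2 * u x ^+ 2 * x 0 i * x 0 k))).

Lemma is_derive_stereo b x i l : is_derive x (delta_mx 0 i)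
  (fun y => stereo b y 0 l) (dstereo b x i 0 l).
Proof.
case: (split_ordP l) => j ->.
  rewrite (ord1 j).
  rewrite (_ : (fun y => _) = (fun y => ((-1) ^+ b *: (1 - 2 *: 'X)).[u y])).
    have := is_derive_radial (delta_mx 0 i)
      (is_derive_poly ((-1) ^+ b *: (1 - 2 *: 'X)) (u x)).
    move/is_derive_eq; apply.
    rewrite dot_delta /dstereo row_mxEl mxE eqxx mulr1n.
    by rewrite !(derivZ, derivB, derivX, derivC) !hornerE /=; ring.
  by apply/funext => y; rewrite stereo_pole !hornerE.
rewrite (_ : (fun y => _) = (fun y : 'rV[R]_n => 2 * (y 0 j * id (u y)))); last first.
  by apply/funext => y; rewrite stereo_rest.
have := is_derive_fM (is_derive_cst (2 : R) x (delta_mx 0 i))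
  (is_derive_coord_radial i j (is_derive_id (u x) (1 : R))).
by move/is_derive_eq; apply; rewrite /dstereo row_mxEr mxE /kron /=; ring.
Qed.

Lemma derive_stereo b x i : 'D_(delta_mx 0 i) (stereo b) x = dstereo b x i.
Proof.
rewrite derive_mx; last first.
  by apply/derivable_mxP => k l; rewrite (ord1 k); have [] := is_derive_stereo b x i l.
by apply/rowP => l; rewrite mxE; have [_ ->] := is_derive_stereo b x i l.
Qed.

Lemma dot_dstereo b x i j :
  dot (dstereo b x i) (dstereo b x j) = kron i j * (4 * u x ^+ 2).
Proof.
rewrite /dot big_split_ord big_ord1 /dstereo.
rewrite !row_mxEl !mxE eqxx !mulr1n.
have e k : row_mx (((-1) ^+ b * (4 * u x ^+ 2 * x 0 i))%:M : 'rV_1)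
    (\row_k (2 * (kron k i * u x - 2 * u x ^+ 2 * x 0 i * x 0 k))) 0 (rshift 1 k) *
  row_mx (((-1) ^+ b * (4 * u x ^+ 2 * x 0 j))%:M : 'rV_1)
    (\row_k (2 * (kron k j * u x - 2 * u x ^+ 2 * x 0 j * x 0 k))) 0 (rshift 1 k) =
  kron i k * (4 * u x * (kron k j * u x - 2 * u x ^+ 2 * x 0 j * x 0 k))
  + (kron j k * (- 8 * u x ^+ 3 * x 0 i * x 0 k)
  + 16 * u x ^+ 4 * x 0 i * x 0 j * (x 0 k * x 0 k)).
  by rewrite !row_mxEr !mxE (kronC i k) (kronC j k); ring.
under eq_bigr do rewrite e.
rewrite !big_split /= !sum_kron -mulr_sumr -/(dot x x) dotE.
rewrite mulrACA -signr_addb addbb mul1r.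
by field; rewrite gt_eqF// u_gt0.
Qed.

Lemma components_conformal (w : sphere R n -> R) b (P : {poly R}) t :
  (forall x, w (chart b x) = 1 + t * P.[u x]) ->
  components (conformal w round_metric) b = radial_metric (conf_poly P t).
Proof.
move=> wE; apply/funext => x; apply/matrixP => i j.
rewrite mxE /conformal wE /round_metric !derive_stereo dot_dstereo.
rewrite /radial_metric mxE conf_polyE /kron -[RHS]mulr_natr; ring.
Qed.

Lemma components_round b :
  components round_metric b = radial_metric (conf_poly (0 : {poly R}) 0) :> (_ -> 'M[R]_n).
Proof.
rewrite -(@components_conformal (fun=> 1) b) => [|x]; last first.
  by rewrite mul0r addr0.
apply/funext => x; apply/matrixP => i j; rewrite !mxE /conformal.
by rewrite mul1r.
Qed.

End stereographic.

Section zonal.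
Context (R : realType) (n : nat) (P : {poly R}).
Local Notation u := (@sphere_u R n).

(** Defined on the sphere itself through the height, so that the chart expressions P(u) and P(1-u)
    are compatible by construction. *)
Definition zonal (p : sphere R n) : R := P.[(1 - val p 0 (lshift n 0)) / 2].

Definition zonal_poly (b : bool) : {poly R} := if b then P \Po (1 - 'X) else P.

Lemma zonal_chart b x : zonal (chart b x) = (zonal_poly b).[u x].
Proof.
rewrite /zonal stereo_pole; case: b => /=.
  by rewrite horner_comp !hornerE /=; congr (_.[_]); field.
by congr (_.[_]); field.
Qed.

Lemma zonal_smooth : smooth_on_sphere zonal.
Proof.
move=> b; rewrite (_ : _ \o _ = fun x => (zonal_poly b).[u x]).
  exact: is_smooth_poly_u.
by apply/funext => x; exact: zonal_chart.
Qed.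

Lemma zonal_eigenfunction lam : (0 < n)%N -> jacobi n P lam -> P.[1] = 1 ->
  is_laplace_eigenfunction round_metric zonal.
Proof.
move=> n_gt0 J P1; split; first exact: zonal_smooth.
  (* At x = 0 one has u = 1, where P is normalised to 1. *)
  exists (chart false 0); rewrite zonal_chart /= /sphere_u.
  rewrite (_ : dot 0 0 = 0) ?addr0 ?invr1 ?P1 ?oner_eq0//.
  by apply: big1 => i _; rewrite mxE mul0r.
exists lam => b x; rewrite components_round.
rewrite (_ : _ \o _ = fun x => (zonal_poly b).[u x]); last first.
  by apply/funext => y; exact: zonal_chart.
rewrite laplacian_round zonal_chart.
have -> : jacobi n (zonal_poly b) lam by case: b => //=; exact: jacobi_comp.
by rewrite mulNr opprK.
Qed.

End zonal.

(** * Moments of 1/(1+|x|^2) *)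

Section one_dimensional_moments.
Context (R : realType) (a : R) (p : nat).
Hypotheses (a_ge1 : 1 <= a) (p_gt0 : (0 < p)%N).
Local Notation mu := (@lebesgue_measure R).

Let w (y : R) : R := (a + y ^+ 2)^-1.
Let f (y : R) : R := w y ^+ p.
Let g (y : R) : R := 2 * p%:R * (y ^+ 2 * w y ^+ p.+1).
(** A multiple of the derivative of atan; it dominates [g] because a >= 1, and its integral over the
    half-line is known. *)
Let H (y : R) : R := 2 * p%:R * (oneDsqr y)^-1.

Let den_gt0 y : 0 < a + y ^+ 2.
Proof. by rewrite ltr_pwDl ?sqr_ge0// (lt_le_trans _ a_ge1). Qed.

Let w_gt0 y : 0 < w y. Proof. by rewrite invr_gt0. Qed.

Let w_ge0 y : 0 <= w y. Proof. exact: ltW. Qed.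

Let w_le y : w y <= (oneDsqr y)^-1.
Proof. by rewrite lef_pV2 ?posrE// ?oneDsqr_gt0// lerD2r. Qed.

Let w_le1 y : w y <= 1.
Proof. by rewrite (le_trans (w_le y))// oneDsqrV_le1. Qed.

Let f_le y : f y <= (oneDsqr y)^-1.
Proof.
apply: le_trans (w_le y); rewrite /f -(prednK p_gt0) exprS.
by rewrite ler_piMr ?w_ge0// exprn_ile1// w_ge0.
Qed.

Let g_le y : g y <= H y.
Proof.
apply: ler_wpM2l; first by rewrite mulr_ge0.
apply: le_trans (f_le y); rewrite (exprS (w y)) mulrA ler_piMl ?exprn_ge0//.
by rewrite ler_pdivrMr// mul1r lerDr (le_trans _ a_ge1).
Qed.

Let f_ge0 y : 0 <= f y. Proof. by rewrite exprn_ge0. Qed.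
Let g_ge0 y : 0 <= g y.
Proof.
by apply: mulr_ge0; [apply: mulr_ge0|apply: mulr_ge0; [exact: sqr_ge0|exact: exprn_ge0]].
Qed.
Let H_ge0 y : 0 <= H y. Proof. by rewrite /H !mulr_ge0 ?invr_ge0 ?oneDsqr_ge0. Qed.

Let cst_cont (c : R) : continuous (fun _ : R => c).
Proof. by move=> x; exact: cvg_cst. Qed.

Let id_cont : continuous (fun y : R => y).
Proof. by move=> x; exact: cvg_id. Qed.

Let pow_cont (k : R -> R) q : continuous k -> continuous (fun y => k y ^+ q).
Proof.
move=> ck; elim: q => [|q IH]; first exact: cst_cont.
by under eq_fun do rewrite exprS; exact: continuous_fM.
Qed.

Let w_cont : continuous w.
Proof.
apply: continuous_fV => [x|]; first exact: lt0r_neq0.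
by apply: continuous_fD; [exact: cst_cont|exact: pow_cont].
Qed.

Let f_cont : continuous f. Proof. exact: pow_cont. Qed.

Let g_cont : continuous g.
Proof.
apply: continuous_fM; first exact: cst_cont.
by apply: continuous_fM; exact: pow_cont.
Qed.

Let H_cont : continuous H.
Proof.
apply: continuous_fM; first exact: cst_cont.
exact: continuous_oneDsqrV.
Qed.

(* The derivative f - g of y f(y) changes sign; adding the integrable H makes
   it nonnegative, as the improper fundamental theorem of calculus requires. *)
Let prim (y : R) : R := y * f y + 2 * p%:R * atan y.
Let dprim (y : R) : R := (f y - g y) + H y.

Let prim_derive (y : R) : is_derive y (1 : R) prim (dprim y).
Proof.
have dsq : is_derive y (1 : R) (fun z : R => a + z ^+ 2) (2 * y).
  have := is_derive_poly (a%:P + 'X^2) y.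
  rewrite (_ : horner _ = (fun z => a + z ^+ 2)); last first.
    by apply/funext => z; rewrite hornerD hornerC hornerXn.
  move/is_derive_eq; apply.
  by rewrite derivD derivC derivXn add0r hornerMn hornerXn mulr_natl.
have dw := @is_derive_fV R R (fun z => a + z ^+ 2) y 1 _ (lt0r_neq0 (den_gt0 y)) dsq.
have df : is_derive y (1 : R) f (- (2 * p%:R * y * w y ^+ p.+1)).
  have := is_derive_chain dw (is_derive_poly 'X^p (w y)).
  rewrite (_ : (fun z => _) = f); last by apply/funext => z; rewrite hornerXn.
  move/is_derive_eq; apply; rewrite derivXn hornerMn hornerXn -/(w y).
  rewrite -[_ / _ ^+ 2](_ : - (2 * y * w y ^+ 2) = _); last first.
    by rewrite /w exprVn mulNr.
  rewrite -(prednK p_gt0) /= !exprS -mulr_natl; ring.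
have := is_deriveD (is_derive_fM (is_derive_id y (1 : R)) df)
  (is_derive_fM (is_derive_cst (2 * p%:R : R) y (1 : R)) (is_derive1_atan y)).
move/is_derive_eq; apply; rewrite /dprim /g /H /oneDsqr /=.
by ring.
Qed.

Let prim_cvg : prim y @[y --> +oo%R] --> 2 * p%:R * (pi / 2).
Proof.
rewrite -[X in _ --> X]add0r; apply: cvgD; last first.
  by apply: cvgM; [exact: cvg_cst|exact: cvgy_atan].
apply/cvgrPdist_le => e e0; near=> y.
have y0 : 0 < y by near: y; exact: nbhs_pinfty_gt.
rewrite sub0r normrN ger0_norm ?mulr_ge0// ?(ltW y0)//.
apply: (@le_trans _ _ y^-1).
  rewrite -ler_pdivlMl// -invfM (le_trans (f_le y))//.
  by rewrite lef_pV2 ?posrE ?mulr_gt0 ?oneDsqr_gt0// -expr2 lerDr.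
by rewrite invf_ple ?posrE//; near: y; apply: nbhs_pinfty_ge; rewrite num_real.
Unshelve. all: by end_near. Qed.

Let mE (k : R -> R) : continuous k -> measurable_fun [set: R] (EFin \o k).
Proof. by move=> ck; apply/measurable_EFinP; exact: continuous_measurable_fun. Qed.

(** Integration by parts: the derivative of y f(y) is f - g, and y f(y) tends to 0 at infinity
    because f is at most 1/(1+y^2). Both integrands are even, so the half-line suffices. *)
Lemma integral_moment1 :
  (\int[mu]_y ((a + y ^+ 2)^-1 ^+ p)%:E =
   \int[mu]_y (2 * p%:R * (y ^+ 2 * (a + y ^+ 2)^-1 ^+ p.+1))%:E)%E.
Proof.
rewrite (@ge0_symfun_integralT _ f)//; last by move=> y; rewrite /f /w /= sqrrN.
rewrite (@ge0_symfun_integralT _ g)//; last by move=> y; rewrite /g /w /= sqrrN.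
rewrite -set_itvcy; congr (_ * _)%E.
have mS (k : R -> R) : continuous k -> measurable_fun (`[(0:R), +oo[%classic : set (measurableTypeR R)) (EFin \o k).
  by move=> ck; apply: measurable_funTS; exact: mE.
have intH : (\int[mu]_(y in `[0%R, +oo[) (H y)%:E = (2 * p%:R * (pi / 2))%:E)%E.
  rewrite EFinM -integral0y_oneDsqr -ge0_integralZl_EFin//.
  by apply: mS; exact: continuous_oneDsqrV.
have dprim_cont : continuous dprim.
  apply: continuous_fD => //; apply: continuous_fD => //.
  by move=> y; apply: cvgN; exact: g_cont.
have dprim_ge0 y : 0 <= dprim y.
  by rewrite /dprim -addrA addr_ge0// addrC subr_ge0.
have prim0 : prim 0 = 0 by rewrite /prim mul0r atan0 mulr0 addr0.
have intD : (\int[mu]_(y in `[0%R, +oo[) (dprim y)%:E = (2 * p%:R * (pi / 2))%:E)%E.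
  rewrite (ge0_continuous_FTC2y _ _ prim_cvg)/=.
  - by rewrite prim0 oppr0 adde0.
  - by [].
  - exact: continuous_subspaceT.
  - by move=> y _; exact: ex_derive.
  - apply: cvg_at_right_filter; apply: differentiable_continuous.
    by apply/derivable1_diffP; exact: ex_derive.
  - by move=> y _; rewrite derive1E; exact: derive_val.
(* [H] and [dprim] have the same finite integral, which can therefore be cancelled in the extended
   reals. *)
have : (\int[mu]_(y in `[0%R, +oo[) (f y)%:E + \int[mu]_(y in `[0%R, +oo[) (H y)%:E =
    \int[mu]_(y in `[0%R, +oo[) (g y)%:E + \int[mu]_(y in `[0%R, +oo[) (dprim y)%:E)%E.
  rewrite -!ge0_integralD//; try by [move=> y _; rewrite lee_fin|exact: mS].
  by apply: eq_integral => y _; rewrite -!EFinD; congr EFin; rewrite /dprim; ring.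
rewrite intH intD => /(congr1 (fun z => z - (2 * p%:R * (pi / 2))%:E)%E).
by rewrite !addeK.
Qed.

End one_dimensional_moments.

(** Inversion is continuous away from 0 and has the default value 0 at 0, hence is measurable by a
    case distinction. *)
Lemma measurable_fun_invr (R : realType) d (T : measurableType d) (f : T -> R) :
  measurable_fun [set: T] f -> measurable_fun [set: T] (fun x => (f x)^-1).
Proof.
move=> mf; apply: (measurableT_comp (f := fun v : R => v^-1)) => //.
rewrite (_ : (fun v => _) = fun v : R => if v == 0 then 0 else v^-1); last first.
  by apply/funext => v; case: eqP => // ->; rewrite invr0.
apply: measurable_fun_if => //.
- have := @measurable_fun_eqr _ _ R setT (fun v : R => v) (cst 0).
  by apply.
- rewrite setTI; apply: open_continuous_measurable_fun.
    rewrite (_ : _ @^-1` _ = [set v : R | v != 0]).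
      exact: open_neq.
    by apply/seteqP; split=> v /=; case: eqP.
  move=> v; rewrite inE /= => /negbT v0; exact: inv_continuous.
Qed.

(** * Fubini on tuples and the recursion for moments *)

Section tuple_integrals.
Context (R : realType).
Local Notation mu1 := (@lebesgue_measure R).
Local Notation mu n := (lebesgue_tuple R n).
Local Notation T n := (n.-tuple (measurableTypeR R)).
Local Open Scope ereal_scope.

Lemma ge0_integral_cons n (f : T n.+1 -> \bar R) :
  measurable_fun setT f -> (forall t, 0 <= f t) ->
  \int[mu n.+1]_t f t = \int[mu1 \x mu n]_z f (cons_pair z).
Proof.
move=> mf f0.
have := @ge0_integral_pushforward _ _ _ _ R (@cons_pair _ _ n)
  (@measurable_cons_pair _ _ n) (mu1 \x mu n) setT f measurableT mf.
by rewrite preimage_setT; apply=> t _; exact: f0.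
Qed.

Lemma ge0_integral_cons1 n (f : T n.+1 -> \bar R) :
  measurable_fun setT f -> (forall t, 0 <= f t) ->
  \int[mu n.+1]_t f t = \int[mu1]_y \int[mu n]_t f (cons_pair (y, t)).
Proof.
move=> mf f0; rewrite ge0_integral_cons//.
apply: (fubini_tonelli1 (f \o @cons_pair _ _ n)) => // [|z]; last exact: f0.
by apply: measurableT_comp => //; exact: measurable_cons_pair.
Qed.

Lemma ge0_integral_cons2 n (f : T n.+1 -> \bar R) :
  measurable_fun setT f -> (forall t, 0 <= f t) ->
  \int[mu n.+1]_t f t = \int[mu n]_t \int[mu1]_y f (cons_pair (y, t)).
Proof.
move=> mf f0; rewrite ge0_integral_cons//.
apply: (fubini_tonelli2 (f \o @cons_pair _ _ n)) => // [|z]; last exact: f0.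
by apply: measurableT_comp => //; exact: measurable_cons_pair.
Qed.

Lemma measurable_ge0_integral_cons1 n (f : T n.+1 -> \bar R) :
  measurable_fun setT f -> (forall t, 0 <= f t) ->
  measurable_fun setT (fun y => \int[mu n]_t f (cons_pair (y, t))).
Proof.
move=> mf f0.
apply: (measurable_fun_fubini_tonelli_F (f \o @cons_pair _ _ n)) => // [|z]; last exact: f0.
by apply: measurableT_comp => //; exact: measurable_cons_pair.
Qed.

End tuple_integrals.

Section moments.
Context (R : realType).
Local Notation mu1 := (@lebesgue_measure R).
Local Notation mu n := (lebesgue_tuple R n).
Local Notation T n := (n.-tuple (measurableTypeR R)).

Definition tuple_sq n (t : T n) : R := \sum_i (tnth t i) ^+ 2.

Lemma tuple_sq_ge0 n (t : T n) : 0 <= tuple_sq t.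
Proof. by apply: sumr_ge0 => i _; exact: sqr_ge0. Qed.

Lemma measurable_tuple_sq n : measurable_fun setT (@tuple_sq n).
Proof.
by apply: measurable_sum => i; apply: measurable_funX; exact: measurable_tnth.
Qed.

Lemma tuple_sq_cons n (y : R) (t : T n) :
  tuple_sq (cons_pair (y, t)) = y ^+ 2 + tuple_sq t.
Proof.
rewrite /tuple_sq big_ord_recl; congr (_ + _).
by apply: eq_bigr => i _; rewrite /cons_pair tnthS.
Qed.

Lemma tuple_sq_nil (t : T 0) : tuple_sq t = 0.
Proof. by rewrite /tuple_sq big_ord0. Qed.

(** The parameter [a] makes induction on the dimension possible: splitting off a coordinate y turns
    [a] into a + y^2. *)
Definition inv_pow (a : R) p n (t : T n) : R := (a + tuple_sq t)^-1 ^+ p.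

Lemma inv_pow_ge0 (a : R) p n (t : T n) : 1 <= a -> 0 <= inv_pow a p t.
Proof.
move=> a1; apply: exprn_ge0; rewrite invr_ge0 addr_ge0 ?tuple_sq_ge0//.
exact: le_trans a1.
Qed.

Lemma measurable_inv_pow (a : R) p n : measurable_fun setT (@inv_pow a p n).
Proof.
apply: measurable_funX; apply: measurable_fun_invr.
by apply: measurable_funD; [exact: measurable_cst|exact: measurable_tuple_sq].
Qed.

Local Open Scope ereal_scope.

Definition moment n (a : R) p : \bar R := \int[mu n]_t (inv_pow a p t)%:E.

Lemma moment_ge0 n a p : (1 <= a)%R -> 0 <= moment n a p.
Proof. by move=> a1; apply: integral_ge0 => t _; rewrite lee_fin inv_pow_ge0. Qed.

Lemma momentS n a p : (1 <= a)%R ->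
  moment n.+1 a p = \int[mu1]_y moment n (a + y ^+ 2)%R p.
Proof.
move=> a1; rewrite /moment ge0_integral_cons1.
- apply: eq_integral => y _; apply: eq_integral => t _.
  by rewrite /inv_pow tuple_sq_cons addrA.
- by apply/measurable_EFinP; exact: measurable_inv_pow.
- by move=> t; rewrite lee_fin inv_pow_ge0.
Qed.

Let le1D (a y : R) : (1 <= a)%R -> (1 <= a + y ^+ 2)%R.
Proof. by move=> a1; rewrite (le_trans a1)// lerDl sqr_ge0. Qed.

Let c_ge0 p (y : R) : (0 <= 2 * p%:R * y ^+ 2)%R.
Proof. by apply: mulr_ge0; [exact: mulr_ge0|exact: sqr_ge0]. Qed.

Lemma measurable_momentS n a p : (1 <= a)%R ->
  measurable_fun (setT : set (measurableTypeR R))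
    (fun y : R => moment n (a + y ^+ 2)%R p).
Proof.
move=> a1.
rewrite (_ : (fun y => _) =
    (fun y => \int[mu n]_t (inv_pow a p (cons_pair (y, t)))%:E)).
  apply: (@measurable_ge0_integral_cons1 R n (fun t => (inv_pow a p t)%:E)).
  - by apply/measurable_EFinP; exact: measurable_inv_pow.
  - by move=> t; rewrite lee_fin inv_pow_ge0.
apply/funext => y; apply: eq_integral => t _.
by rewrite /inv_pow tuple_sq_cons addrA.
Qed.

(** Integration by parts in the first coordinate. With the other coordinates t fixed, the inner
    integral is [integral_moment1] for a + |t|^2; Fubini is used in one order to form the integral
    on tuples and in the other to reach the inner one. *)
Lemma moment_head n a p : (1 <= a)%R -> (0 < p)%N ->
  \int[mu1]_y ((2 * p%:R * y ^+ 2)%:E * moment n (a + y ^+ 2)%R p.+1) =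
  moment n.+1 a p.
Proof.
move=> a1 p0.
pose f (t : T n.+1) : \bar R :=
  (2 * p%:R * (tnth t ord0 ^+ 2 * inv_pow a p.+1 t))%:E.
have f0 t : 0 <= f t.
  rewrite lee_fin; apply: mulr_ge0; first by apply: mulr_ge0.
  by apply: mulr_ge0; [exact: sqr_ge0|exact: inv_pow_ge0].
have mf : measurable_fun setT f.
  apply/measurable_EFinP; apply: measurable_funM; first exact: measurable_cst.
  apply: measurable_funM; last exact: measurable_inv_pow.
  by apply: measurable_funX; exact: measurable_tnth.
transitivity (\int[mu n.+1]_t f t).
  rewrite ge0_integral_cons1//; apply: eq_integral => y _.
  rewrite /moment -ge0_integralZl_EFin//.
  - apply: eq_integral => t _.
    by rewrite /f /inv_pow tuple_sq_cons addrA -EFinM mulrA.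
  - by move=> t _; rewrite lee_fin inv_pow_ge0// le1D.
  - by apply/measurable_EFinP; exact: measurable_inv_pow.
rewrite ge0_integral_cons2// /moment ge0_integral_cons2; last 2 first.
- by apply/measurable_EFinP; exact: measurable_inv_pow.
- by move=> t; rewrite lee_fin inv_pow_ge0.
apply: eq_integral => t _.
have at1 : (1 <= a + tuple_sq t)%R by rewrite (le_trans a1)// lerDl tuple_sq_ge0.
have := integral_moment1 at1 p0.
have e y : (a + tuple_sq t + y ^+ 2 = a + tuple_sq (cons_pair (y, t)))%R.
  by rewrite tuple_sq_cons addrA addrAC.
move=> E; symmetry.
transitivity (\int[mu1]_y ((a + tuple_sq t + y ^+ 2)^-1 ^+ p)%:E).
  by apply: eq_integral => y _; rewrite e.
by rewrite E; apply: eq_integral => y _; rewrite e.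
Qed.

(* Integration by parts in each coordinate: sum_i int d_i (x_i (a+|x|^2)^-p) = 0. *)
Lemma moment_rec n a p : (1 <= a)%R -> (0 < p)%N ->
  (2 * p%:R * a)%:E * moment n a p.+1 + n%:R%:E * moment n a p =
  (2 * p%:R)%:E * moment n a p.
Proof.
elim: n a => [|n IH] a a1 p0.
  (* In dimension 0 the measure is a Dirac mass and the moment of order q is a^-q. *)
  rewrite mul0e adde0 /moment.
  have a0 : (a != 0)%R by rewrite gt_eqF// (lt_le_trans _ a1).
  have e q : \int[mu 0]_t (inv_pow a q t)%:E = (a^-1 ^+ q)%:E.
    under eq_integral do rewrite /inv_pow tuple_sq_nil addr0.
    by rewrite integral_cst// -[RHS]mule1; congr (_ * _); exact: diracT.
  rewrite !e -!EFinM; congr EFin; rewrite exprS.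
  by rewrite mulrA -(mulrA _ a) divff// mulr1.
have mm q := @measurable_momentS n a q a1.
have mm0 q (y : R) : 0 <= moment n (a + y ^+ 2)%R q by rewrite moment_ge0// le1D.
have msq : measurable_fun (setT : set (measurableTypeR R))
    (fun y : R => (2 * p%:R * y ^+ 2)%:E).
  apply/measurable_EFinP; apply: measurable_funM; first exact: measurable_cst.
  exact: measurable_funX.
(* The induction hypothesis at a + y^2, integrated in y. By [moment_head] the term with y^2
   contributes one further copy of the moment of order p, which raises the factor n to n + 1. *)
have : \int[mu1]_y ((2 * p%:R * a)%:E * moment n (a + y ^+ 2)%R p.+1
      + ((2 * p%:R * y ^+ 2)%:E * moment n (a + y ^+ 2)%R p.+1
      + n%:R%:E * moment n (a + y ^+ 2)%R p)) =
    \int[mu1]_y ((2 * p%:R)%:E * moment n (a + y ^+ 2)%R p).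
  apply: eq_integral => y _; rewrite -IH ?le1D// addeA; congr (_ + _).
  rewrite -ge0_muleDl ?lee_fin; first by rewrite -EFinD mulrDr.
  - by rewrite !mulr_ge0// (le_trans _ a1).
  - exact: c_ge0.
have p2 : (0 <= 2 * p%:R * a)%R by rewrite !mulr_ge0// (le_trans _ a1).
have n0 : (0 <= n%:R :> R)%R by [].
rewrite ge0_integralD//; last 4 first.
- by move=> y _; rewrite mule_ge0.
- exact: measurable_funeM.
- by move=> y _; rewrite adde_ge0 ?mule_ge0// lee_fin c_ge0.
- by apply: emeasurable_funD; [exact: emeasurable_funM|exact: measurable_funeM].
rewrite ge0_integralD//; last 4 first.
- by move=> y _; rewrite mule_ge0// lee_fin c_ge0.
- exact: emeasurable_funM.
- by move=> y _; rewrite mule_ge0.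
- exact: measurable_funeM.
rewrite !ge0_integralZl_EFin// moment_head// -!momentS// => <-.
congr (_ + _); rewrite -natr1 EFinD ge0_muleDl ?lee_fin//.
by rewrite mul1e addeC.
Qed.

End moments.

(** * Product functions and finiteness of moments *)

Section product_integrals.
Context (R : realType).
Local Notation mu1 := (@lebesgue_measure R).
Local Notation mu n := (lebesgue_tuple R n).
Local Notation T n := (n.-tuple (measurableTypeR R)).

Variable psi : measurableTypeR R -> R.
Hypotheses (mpsi : measurable_fun setT psi) (psi_ge0 : forall y, 0 <= psi y).

Lemma measurable_tuple_prod n :
  measurable_fun setT (fun t : T n => \prod_i psi (tnth t i)).
Proof.
apply: measurable_prod => i _; apply: measurableT_comp => //.
exact: measurable_tnth.
Qed.

Lemma tuple_prod_ge0 n (t : T n) : 0 <= \prod_i psi (tnth t i).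
Proof. by apply: prodr_ge0. Qed.

(** Products serve as comparison functions, from above in [moment_fin] and from below in
    [wint_pos]. *)
Lemma integral_tuple_prod n :
  (\int[mu n]_t (\prod_i psi (tnth t i))%:E = (\int[mu1]_y (psi y)%:E) ^+ n)%E.
Proof.
elim: n => [|n IH].
  under eq_integral do rewrite big_ord0.
  by rewrite integral_cst// mul1e expe0; exact: diracT.
rewrite ge0_integral_cons1; last 2 first.
- by apply/measurable_EFinP; exact: measurable_tuple_prod.
- by move=> t; rewrite lee_fin tuple_prod_ge0.
have I0 : (0 <= \int[mu n]_t (\prod_i psi (tnth t i))%:E)%E.
  by apply: integral_ge0 => t _; rewrite lee_fin tuple_prod_ge0.
transitivity (\int[mu1]_y ((\int[mu n]_t (\prod_i psi (tnth t i))%:E) * (psi y)%:E)%E)%E.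
  apply: eq_integral => y _.
  rewrite muleC -ge0_integralZl_EFin//.
  - apply: eq_integral => t _; rewrite -EFinM big_ord_recl; congr (_ * _)%:E.
    by apply: eq_bigr => i _; rewrite /cons_pair tnthS.
  - by move=> t _; rewrite lee_fin tuple_prod_ge0.
  - by apply/measurable_EFinP; exact: measurable_tuple_prod.
rewrite ge0_integralZl//.
- by rewrite IH expeS muleC.
- exact/measurable_EFinP.
- by move=> y _; rewrite lee_fin.
Qed.

End product_integrals.

Section finite_moment.
Context (R : realType).
Local Notation mu1 := (@lebesgue_measure R).
Local Notation mu n := (lebesgue_tuple R n).

(** Since 1 + y_i^2 <= 1 + |y|^2 for each of the n coordinates, the integrand is at most the product
    of the 1/(1+y_i^2), whose integral is pi^n. *)
Lemma moment_fin n : (moment n (1 : R) n < +oo)%E.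
Proof.
pose psi (y : measurableTypeR R) := (oneDsqr (y : R))^-1.
have psi0 y : 0 <= psi y by rewrite invr_ge0 ltW// oneDsqr_gt0.
have cpsi : continuous (psi : R -> R) by exact: continuous_oneDsqrV.
have mpsi : measurable_fun setT psi by exact: continuous_measurable_fun.
apply: (@le_lt_trans _ _ ((\int[mu1]_y (psi y)%:E) ^+ n)%E).
  rewrite -(integral_tuple_prod mpsi psi0); apply: ge0_le_integral => //.
  - by move=> t _; rewrite lee_fin inv_pow_ge0.
  - by apply/measurable_EFinP; exact: measurable_inv_pow.
  - by apply/measurable_EFinP; exact: measurable_tuple_prod.
  - move=> t _; rewrite lee_fin /inv_pow.
    rewrite -[X in _ ^+ X]card_ord -prodr_const.
    apply: ler_prod => i _; rewrite invr_ge0 addr_ge0 ?tuple_sq_ge0 ?sqr_ge0//=.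
    rewrite lef_pV2 ?posrE ?oneDsqr_gt0 ?ltr_pwDl ?tuple_sq_ge0 ?sqr_ge0//.
    rewrite lerD2l /tuple_sq (bigD1 i)//= lerDl.
    by apply: sumr_ge0 => j _; exact: sqr_ge0.
suff -> : (\int[mu1]_y (psi y)%:E = pi%:E)%E by rewrite -EFin_expe ltry.
rewrite (@ge0_symfun_integralT _ psi)//; last first.
  by move=> y /=; rewrite /psi /oneDsqr sqrrN.
rewrite -set_itvcy integral0y_oneDsqr -EFinM; congr EFin.
by rewrite mulrC divfK.
Qed.

End finite_moment.

(** * Expansion of the curvature integrals *)

Lemma horner_bound (R : realType) (p : {poly R}) :
  exists2 K, 0 <= K & forall v : R, 0 <= v -> v <= 1 -> `|p.[v]| <= K.
Proof.
exists (\sum_(i < size p) `|p`_i|); first exact: sumr_ge0.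
move=> v v0 v1; rewrite horner_coef (le_trans (ler_norm_sum _ _ _))//.
apply: ler_sum => i _; rewrite normrM ler_piMr// normrX exprn_ile1//.
by rewrite ger0_norm.
Qed.

Section bounded_families.
Context (R : realType) (t0 : R).
Implicit Types phi psi : R -> R -> R.

(* Families phi_t(v), bounded uniformly in 0 < t < t0 and v in (0, 1]: the O(1)
   of the expansions in t. *)
Definition bounded_family phi : Prop :=
  (forall t, measurable_fun setT (phi t)) /\
  exists2 K, 0 <= K &
    forall t v, 0 < t -> t < t0 -> 0 < v -> v <= 1 -> `|phi t v| <= K.

Lemma bf_cst (c : R -> R) K : (forall t, 0 < t -> t < t0 -> `|c t| <= K) ->
  bounded_family (fun t _ => c t).
Proof.
move=> cK; split=> [t|]; first exact: measurable_cst.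
by exists `|K| => // t v tp tt0 _ _; rewrite (le_trans (cK t tp tt0))// ler_norm.
Qed.

Lemma bf_const (c : R) : bounded_family (fun _ _ => c).
Proof. exact: (@bf_cst _ `|c|). Qed.

Lemma bf_t : bounded_family (fun t _ => t).
Proof. by apply: (@bf_cst _ t0) => t tp tt0; rewrite gtr0_norm// ltW. Qed.

Lemma bf_poly (p : {poly R}) : bounded_family (fun _ v => p.[v]).
Proof.
split=> [t|].
  by apply: continuous_measurable_fun; exact: continuous_horner.
have [K K0 pK] := horner_bound p.
by exists K => // t v _ _ v0 v1; rewrite pK// ltW.
Qed.

Lemma bf_id : bounded_family (fun _ v => v).
Proof.
split=> [t|]; first exact: measurable_id.
by exists 1 => // t v _ _ v0 v1; rewrite gtr0_norm.
Qed.

Lemma bfD phi psi : bounded_family phi -> bounded_family psi ->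
  bounded_family (fun t v => phi t v + psi t v).
Proof.
move=> [mp [K K0 pK]] [mq [L L0 qL]]; split=> [t|].
  exact: measurable_funD.
exists (K + L); first exact: addr_ge0.
by move=> t v t1 t2 v0 v1; rewrite (le_trans (ler_normD _ _))// lerD ?pK ?qL.
Qed.

Lemma bfM phi psi : bounded_family phi -> bounded_family psi ->
  bounded_family (fun t v => phi t v * psi t v).
Proof.
move=> [mp [K K0 pK]] [mq [L L0 qL]]; split=> [t|].
  exact: measurable_funM.
exists (K * L); first exact: mulr_ge0.
by move=> t v t1 t2 v0 v1; rewrite normrM ler_pM ?pK ?qL.
Qed.

Lemma bfN phi : bounded_family phi -> bounded_family (fun t v => - phi t v).
Proof.
move=> pb; rewrite (_ : (fun t v => _) = (fun t v => -1 * phi t v)).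
  by apply: bfM => //; exact: bf_const.
by apply/funext => t; apply/funext => v; rewrite mulN1r.
Qed.

Lemma bfB phi psi : bounded_family phi -> bounded_family psi ->
  bounded_family (fun t v => phi t v - psi t v).
Proof. by move=> pb qb; apply: bfD => //; exact: bfN. Qed.

Lemma bfX phi q : bounded_family phi -> bounded_family (fun t v => phi t v ^+ q).
Proof.
move=> pb; elim: q => [|q IH]; first exact: bf_const.
rewrite (_ : (fun t v => _) = (fun t v => phi t v * phi t v ^+ q)).
  exact: bfM.
by apply/funext => t; apply/funext => v; rewrite exprS.
Qed.

Lemma bf_sum m (phi : 'I_m -> R -> R -> R) : (forall i, bounded_family (phi i)) ->
  bounded_family (fun t v => \sum_i phi i t v).
Proof.
elim: m phi => [|m IH] phi pb.
  rewrite (_ : (fun t v => _) = (fun _ _ => 0)); first exact: bf_const.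
  by apply/funext => t; apply/funext => v; rewrite big_ord0.
rewrite (_ : (fun t v => _) =
    (fun t v => phi ord0 t v + \sum_i phi (lift ord0 i) t v)).
  by apply: bfD => //; exact: IH.
by apply/funext => t; apply/funext => v; rewrite big_ord_recl.
Qed.

Lemma bfV phi c : 0 < c -> bounded_family phi ->
  (forall t v, 0 < t -> t < t0 -> 0 < v -> v <= 1 -> c <= phi t v) ->
  bounded_family (fun t v => (phi t v)^-1).
Proof.
move=> c0 [mp _] pc; split=> [t|]; first exact: measurable_fun_invr.
exists c^-1; first by rewrite invr_ge0 ltW.
move=> t v t1 t2 v0 v1; have cp := pc _ _ t1 t2 v0 v1.
have p0 := lt_le_trans c0 cp.
by rewrite gtr0_norm ?invr_gt0// lef_pV2.
Qed.

Lemma bf_sqrt phi : bounded_family phi ->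
  bounded_family (fun t v => Num.sqrt (phi t v)).
Proof.
move=> [mp [K K0 pK]]; split=> [t|].
  apply: measurableT_comp => //; apply: continuous_measurable_fun.
  exact: sqrt_continuous.
exists (Num.sqrt K); first exact: sqrtr_ge0.
move=> t v t1 t2 v0 v1; rewrite ger0_norm ?sqrtr_ge0//.
by rewrite ler_wsqrtr// (le_trans (ler_norm _))// pK.
Qed.

End bounded_families.

(** * Integrals of functions of u over the sphere *)

Section weighted_integral.
Context (R : realType) (n : nat).
Local Notation mu := (lebesgue_tuple R n).
Local Notation T := (n.-tuple (measurableTypeR R)).
Implicit Types phi psi : R -> R.

Definition tuple_u (t : T) : R := (1 + tuple_sq t)^-1.

Lemma tuple_u_gt0 t : 0 < tuple_u t.
Proof. by rewrite invr_gt0 ltr_pwDl ?tuple_sq_ge0. Qed.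

Lemma tuple_u_le1 t : tuple_u t <= 1.
Proof. by rewrite invf_le1 ?ltr_pwDl ?tuple_sq_ge0// lerDl tuple_sq_ge0. Qed.

Lemma measurable_tuple_u : measurable_fun setT tuple_u.
Proof.
apply: measurable_fun_invr.
by apply: measurable_funD; [exact: measurable_cst|exact: measurable_tuple_sq].
Qed.

(** The round volume density is (2u)^n, so this is the integral of phi(u) over the round sphere
    divided by 2^n. *)
Definition wint phi : R := \int[mu]_t (phi (tuple_u t) * tuple_u t ^+ n).

Definition bounded01 phi : Prop := measurable_fun setT phi /\
  exists2 K, 0 <= K & forall v, 0 < v -> v <= 1 -> `|phi v| <= K.

Lemma bf_bounded01 t0 (phi : R -> R -> R) t : bounded_family t0 phi -> 0 < t -> t < t0 ->
  bounded01 (phi t).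
Proof.
move=> [mp [K K0 pK]] t1 t2; split=> //.
by exists K => // v v0 v1; exact: pK.
Qed.

Lemma bounded01_poly (p : {poly R}) : bounded01 (horner p).
Proof.
by apply: (bf_bounded01 (t0 := 1) (t := 2^-1) (bf_poly 1 p)); lra.
Qed.

Lemma integrable_inv_pow q : (n <= q)%N ->
  mu.-integrable setT (fun t => (inv_pow 1 q t)%:E).
Proof.
move=> nq; apply/integrableP; split.
  by apply/measurable_EFinP; exact: measurable_inv_pow.
apply: le_lt_trans (moment_fin R n); apply: ge0_le_integral => //.
- by apply: measurableT_comp => //; apply/measurable_EFinP; exact: measurable_inv_pow.
- by apply/measurable_EFinP; exact: measurable_inv_pow.
- move=> t _; rewrite gee0_abs ?lee_fin ?inv_pow_ge0//.
  by rewrite /inv_pow ler_wiXn2l// ?(ltW (tuple_u_gt0 t)) ?tuple_u_le1.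
Qed.

Lemma integrable_weighted phi : bounded01 phi ->
  mu.-integrable setT (EFin \o (fun t => phi (tuple_u t) * tuple_u t ^+ n)).
Proof.
move=> [mphi [K K0 pK]].
have mf : measurable_fun setT (fun t => phi (tuple_u t) * tuple_u t ^+ n).
  apply: measurable_funM; last by apply: measurable_funX; exact: measurable_tuple_u.
  by apply: measurableT_comp => //; exact: measurable_tuple_u.
apply: (@le_integrable _ _ _ mu setT measurableT _ (fun t => K%:E * (inv_pow 1 n t)%:E)%E).
- exact/measurable_EFinP.
- move=> t _; rewrite /= lee_fin.
  rewrite normrM [X in _ <= X]ger0_norm; last by rewrite mulr_ge0// inv_pow_ge0.
  apply: ler_pM => //; first by rewrite pK ?tuple_u_gt0 ?tuple_u_le1.
  by rewrite ger0_norm// exprn_ge0// ltW// tuple_u_gt0.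
- by apply: integrableZl => //; exact: integrable_inv_pow.
Qed.

Lemma eq_wint phi psi : (forall v, 0 < v -> v <= 1 -> phi v = psi v) ->
  wint phi = wint psi.
Proof.
by move=> e; apply: eq_Rintegral => t _; rewrite e ?tuple_u_gt0 ?tuple_u_le1.
Qed.

Lemma wintD phi psi : bounded01 phi -> bounded01 psi ->
  wint (fun v => phi v + psi v) = wint phi + wint psi.
Proof.
move=> pb qb; rewrite /wint -RintegralD//; try exact: integrable_weighted.
by apply: eq_Rintegral => t _; rewrite mulrDl.
Qed.

Lemma wintZ c phi : bounded01 phi -> wint (fun v => c * phi v) = c * wint phi.
Proof.
move=> pb; rewrite /wint -RintegralZl//; last exact: integrable_weighted.
by apply: eq_Rintegral => t _; rewrite mulrA.
Qed.

Lemma wint_ge0 phi : (forall v, 0 < v -> v <= 1 -> 0 <= phi v) -> 0 <= wint phi.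
Proof.
move=> p0; apply: Rintegral_ge0 => t _.
by rewrite mulr_ge0 ?p0 ?exprn_ge0 ?(ltW (tuple_u_gt0 t)) ?tuple_u_gt0 ?tuple_u_le1.
Qed.

Lemma le_wint phi psi : bounded01 phi -> bounded01 psi ->
  (forall v, 0 < v -> v <= 1 -> phi v <= psi v) -> wint phi <= wint psi.
Proof.
move=> pb qb pq; apply: le_Rintegral => //; try exact: integrable_weighted.
move=> t _; apply: ler_wpM2r; last by rewrite pq ?tuple_u_gt0 ?tuple_u_le1.
by rewrite exprn_ge0// ltW// tuple_u_gt0.
Qed.

Lemma bounded01_cst (c : R) : bounded01 (fun _ => c).
Proof. by split; [exact: measurable_cst|exists `|c|]. Qed.

Lemma bounded01Z (c : R) phi : bounded01 phi -> bounded01 (fun v => c * phi v).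
Proof.
move=> [mp [L L0 pL]]; split.
  by apply: measurable_funM => //; exact: measurable_cst.
exists (`|c| * L); first by rewrite mulr_ge0.
by move=> v v0 v1; rewrite normrM ler_wpM2l// pL.
Qed.

Lemma bounded01D phi psi : bounded01 phi -> bounded01 psi ->
  bounded01 (fun v => phi v + psi v).
Proof.
move=> [mp [K K0 pK]] [mq [L L0 qL]]; split; first exact: measurable_funD.
exists (K + L); first exact: addr_ge0.
by move=> v v0 v1; rewrite (le_trans (ler_normD _ _))// lerD ?pK ?qL.
Qed.

Lemma wint_norm_le phi K : bounded01 phi ->
  (forall v, 0 < v -> v <= 1 -> `|phi v| <= K) ->
  `|wint phi| <= K * wint (fun=> 1).
Proof.
move=> pb pK; rewrite -wintZ; last exact: bounded01_cst.
have cb : forall c : R, bounded01 (fun _ => c * 1) by move=> c; exact: bounded01_cst.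
rewrite ler_norml -mulN1r -wintZ//; apply/andP; split.
  apply: le_wint => //.
    rewrite (_ : (fun _ => _) = (fun=> -1 * (K * 1)))//; exact: bounded01_cst.
  by move=> v v0 v1; rewrite mulN1r mulr1 lerNl (le_trans (ler_norm _))// normrN pK.
by apply: le_wint => // v v0 v1; rewrite mulr1 (le_trans (ler_norm _))// pK.
Qed.

Lemma wint_Xn j : wint (fun v => v ^+ j) = fine (moment n 1 (n + j)).
Proof.
rewrite /wint /Rintegral /moment; congr fine.
by apply: eq_integral => t _; rewrite /inv_pow -/(tuple_u t) -exprD addnC.
Qed.

(** This is [moment_rec] with a = 1 and p = n + j, halved; the subtraction is legitimate because the
    moments of order at least n are finite. *)
Lemma wint_Xn_rec j : (0 < n)%N ->
  (j%:R + n%:R / 2) * wint (fun v => v ^+ j) =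
  (n + j)%:R * wint (fun v => v ^+ j.+1).
Proof.
move=> n0; rewrite !wint_Xn addnS.
have fin q : (n <= q)%N -> moment n (1 : R) q \is a fin_num.
  by move=> nq; apply: integrable_fin_num => //; exact: integrable_inv_pow.
have := @moment_rec R n 1 (n + j) (lexx _); rewrite addn_gt0 n0 => /(_ isT).
have f1 := fin (n + j) (leq_addr _ _).
have f2 : moment n (1 : R) (n + j).+1 \is a fin_num.
  by apply: fin; rewrite leqW// leq_addr.
rewrite -(fineK f1) -(fineK f2) /= -!EFinM -EFinD => -[].
rewrite natrD; move: (fine _) (fine _) => x y E; lra.
Qed.

(* The divergence theorem for the vector field u^n V(u) x. *)
Lemma wint_divergence (V : {poly R}) : (0 < n)%N ->
  wint (fun v => v * (1 - v) * V^`().[v] + n%:R / 2 * (1 - 2 * v) * V.[v]) = 0.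
Proof.
move=> n0.
pose op (W : {poly R}) :=
  'X * (1 - 'X) * W^`() + (n%:R / 2) *: ((1 - 2 *: 'X) * W) : {poly R}.
have opE W v : (op W).[v] =
    v * (1 - v) * W^`().[v] + n%:R / 2 * (1 - 2 * v) * W.[v].
  by rewrite /op !hornerE /=; ring.
suff : wint (horner (op V)) = 0.
  by move=> <-; apply: eq_wint => v _ _; rewrite opE.
have b01 := bounded01_poly.
(* By linearity V may be taken to be X^i, for which the integrand is (i + n/2) v^i - (n + i) v^(i+1)
   and the claim is the recursion for moments. *)
rewrite -[V]coefK poly_def; elim/big_ind : _ => [|W W' WE WE'|i _].
- rewrite -[RHS](mul0r (wint (horner (op 0)))) -wintZ//.
  by apply: eq_wint => v _ _; rewrite opE deriv0 !horner0; ring.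
- rewrite -[RHS]addr0 -[X in _ = X + _]WE -[X in _ = _ + X]WE' -wintD//.
  by apply: eq_wint => v _ _; rewrite !opE derivD !hornerD; ring.
have bX q : bounded01 (fun v => v ^+ q).
  by have := b01 'X^q; rewrite (_ : horner _ = fun v => v ^+ q)//;
     apply/funext => v; rewrite hornerXn.
have bcX c q : bounded01 (fun v => c * v ^+ q).
  have := b01 (c *: 'X^q); rewrite (_ : horner _ = fun v => c * v ^+ q)//.
  by apply/funext => v; rewrite hornerZ hornerXn.
transitivity (wint (fun v => V`_i * (i%:R + n%:R / 2) * v ^+ i
    + (- V`_i * (n + i)%:R) * v ^+ i.+1)).
  apply: eq_wint => v _ _; rewrite opE derivZ derivXn !(hornerZ, hornerMn, hornerXn) natrD.
  case: (nat_of_ord i) => [|j] /=; first by rewrite mulr0n; field.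
  by rewrite -mulr_natl -natr1 !exprS /=; field.
rewrite wintD// !wintZ// -!mulrA wint_Xn_rec// mulNr subrr//.
Qed.

(** By continuity p >= p(1)/2 for u close to 1, that is, for x in a small cube around 0. The
    integrand thus dominates a positive multiple of the indicator of that cube, a product
    function. *)
Lemma wint_pos (p : {poly R}) : (forall v, 0 < v -> v <= 1 -> 0 <= p.[v]) ->
  0 < p.[1] -> 0 < wint (horner p).
Proof.
move=> p_ge0 p1.
have [d d0 pd] : exists2 d : R, 0 < d &
    forall v, 0 < v -> v <= 1 -> 1 - d < v -> p.[1] / 2 <= p.[v].
  have := @continuous_horner R p 1; move/cvgrPdist_lt => /(_ (p.[1] / 2)).
  rewrite divr_gt0// => /(_ isT)[e /= e0 He]; exists e => // v v0 v1 dv.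
  have ball_v : `|1 - v| < e by rewrite ger0_norm ?subr_ge0// ltrBlDr -ltrBlDl.
  by have := ltW (He v ball_v); rewrite ler_norml => /andP[_ ?]; lra.
(* On the cube |x_i| < s, s <= 1 gives |x|^2 <= n s <= d/2, hence 1 - d < 1/(1 + n s) <= u. The
   divisor uses n + 1 so as never to vanish. *)
pose s := Num.min 1 (d / (2 * n.+1%:R)).
have n1_gt0 : 0 < n.+1%:R :> R by rewrite ltr0n.
have s0 : 0 < s by rewrite lt_min ltr01 divr_gt0// mulr_gt0.
have s1 : s <= 1 by rewrite ge_min lexx.
have sd : n%:R * s <= d / 2.
  have : s <= d / (2 * n.+1%:R) by rewrite ge_min lexx orbT.
  rewrite ler_pdivlMr ?mulr_gt0// => H.
  rewrite ler_pdivlMr// (le_trans _ H)// -natr1.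
  rewrite (_ : s * _ = n%:R * s * 2 + 2 * s); last by ring.
  by rewrite lerDl mulr_ge0// ltW.
pose I : set (measurableTypeR R) := `](- s), s[%classic.
pose psi : measurableTypeR R -> R := \1_I.
have mI : measurable I by exact: measurable_itv.
have mpsi : measurable_fun setT psi by exact: measurable_indic.
have psi0 y : 0 <= psi y by rewrite /psi indicE.
have intpsi : (\int[@lebesgue_measure R]_y (psi y)%:E = (2 * s)%:E)%E.
  rewrite integral_indic// setIT.
  apply: (etrans (lebesgue_measure_itv `](- s), s[)); rewrite /= lte_fin.
  by rewrite gtrN// -EFinD; congr EFin; ring.
have ns_ge0 : 0 <= n%:R * s by rewrite mulr_ge0// ltW.
pose c := p.[1] / 2 * (1 + n%:R * s)^-1 ^+ n.
have c0 : 0 < c.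
  by rewrite mulr_gt0 ?divr_gt0// exprn_gt0// invr_gt0 ltr_pwDl.
have lower (t : T) : c * \prod_i psi (tnth t i) <= p.[tuple_u t] * tuple_u t ^+ n.
  have [tI|tNI] := pselect (forall i, I (tnth t i)); last first.
    have /existsNP[i tNi] := tNI.
    rewrite (bigD1 i)//= /psi [X in _ * (X * _)]indicE memNset// mul0r mulr0.
    by rewrite mulr_ge0 ?p_ge0 ?exprn_ge0 ?(ltW (tuple_u_gt0 t)) ?tuple_u_gt0 ?tuple_u_le1.
  have ts : tuple_sq t <= n%:R * s.
    rewrite -[n in n%:R * s]card_ord -sum1_card natr_sum mulr_suml; apply: ler_sum => i _.
    have := tI i; rewrite /I /= in_itv /= mul1r -ltr_norml => ti.
    rewrite -[leLHS]ger0_norm ?sqr_ge0// normrX expr2.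
    apply: (@le_trans _ _ (s * 1)); last by rewrite mulr1.
    by apply: ler_pM => //; apply: ltW => //; exact: lt_le_trans s1.
  have u_ge : (1 + n%:R * s)^-1 <= tuple_u t.
    by rewrite lef_pV2 ?posrE ?lerD2l ?ltr_pwDl ?tuple_sq_ge0.
  rewrite big1 ?mulr1 => [|i _]; last by rewrite /psi indicE mem_set.
  apply: ler_pM.
  - by rewrite divr_ge0// ltW.
  - by rewrite exprn_ge0// invr_ge0 addr_ge0.
  - apply: pd; rewrite ?tuple_u_gt0 ?tuple_u_le1//.
    apply: lt_le_trans u_ge; rewrite -[ltRHS]mul1r ltr_pdivlMr ?ltr_pwDl//.
    have : (1 - d) * (1 + n%:R * s) = 1 + n%:R * s - d - d * (n%:R * s) by ring.
    have : 0 <= d * (n%:R * s) by rewrite mulr_ge0// ltW.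
    lra.
  - by rewrite lerXn2r ?nnegrE ?invr_ge0 ?addr_ge0 ?tuple_sq_ge0.
have mprod : measurable_fun setT (fun t : T => \prod_i psi (tnth t i)).
  exact: measurable_tuple_prod.
have iprod : (\int[mu]_t (c * \prod_i psi (tnth t i))%:E = (c * (2 * s) ^+ n)%:E)%E.
  under eq_integral do rewrite EFinM.
  rewrite ge0_integralZl_EFin//.
  - by rewrite (integral_tuple_prod mpsi psi0) intpsi -EFin_expe EFinM.
  - by move=> t _; rewrite lee_fin tuple_prod_ge0.
  - exact/measurable_EFinP.
  - exact: ltW.
apply: (@lt_le_trans _ _ (c * (2 * s) ^+ n)); first by rewrite mulr_gt0 ?exprn_gt0// mulr_gt0.
have iw := integrable_weighted (bounded01_poly p).
rewrite /wint /Rintegral -lee_fin fineK; last exact: integrable_fin_num.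
rewrite -iprod; apply: ge0_le_integral => //.
- move=> t _; rewrite lee_fin mulr_ge0 ?(ltW c0)//.
  exact: tuple_prod_ge0.
- by apply/measurable_EFinP; apply: measurable_funM => //; exact: measurable_cst.
- by case/integrableP : iw.
- by move=> t _; rewrite lee_fin lower.
Qed.

End weighted_integral.

(** * Expansions in t with uniform remainders *)

Section expansion.
Context (R : realType) (n : nat) (P : {poly R}) (t0 : R).
Hypothesis t0P : forall t v, 0 < t -> t < t0 -> 0 < v -> v <= 1 ->
  `|t * P.[v]| <= 2^-1.
Local Notation bf := (bounded_family t0).

Definition dens (t v : R) : R := 1 + t * P.[v].

Lemma dens_ge t v : 0 < t -> t < t0 -> 0 < v -> v <= 1 -> 2^-1 <= dens t v.
Proof.
move=> t1 t2 v0 v1; have := t0P t1 t2 v0 v1.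
by rewrite ler_norml /dens => /andP[? _]; lra.
Qed.

Lemma dens_gt0 t v : 0 < t -> t < t0 -> 0 < v -> v <= 1 -> 0 < dens t v.
Proof. by move=> t1 t2 v0 v1; apply: lt_le_trans (dens_ge t1 t2 v0 v1). Qed.

Lemma bf_dens : bf dens.
Proof. by apply: bfD; [exact: bf_const|apply: bfM; [exact: bf_t|exact: bf_poly]]. Qed.

Lemma bf_dens_inv : bf (fun t v => (dens t v)^-1).
Proof. by apply: (bfV (c := 2^-1)) => //; [exact: bf_dens|exact: dens_ge]. Qed.

(* The volume density of g_t is [(2 u)^n * vol t u]. *)
Definition vol (t v : R) : R := Num.sqrt (dens t v ^+ n).

Lemma vol_ge0 t v : 0 <= vol t v. Proof. exact: sqrtr_ge0. Qed.

Lemma bf_vol : bf vol.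
Proof. by apply: bf_sqrt; apply: bfX; exact: bf_dens. Qed.

(** The quotient (vol - 1)/t without a derivative of the square root: vol^2 - 1 = D^n - 1, with D =
    1 + tP, is tP times a geometric sum, and it is divided by vol + 1 >= 1. *)
Definition vol_rem (t v : R) : R :=
  P.[v] * (\sum_(i < n) dens t v ^+ i) * (vol t v + 1)^-1.

Lemma bf_vol_rem : bf vol_rem.
Proof.
apply: bfM.
  apply: bfM; first exact: bf_poly.
  by apply: bf_sum => i; apply: bfX; exact: bf_dens.
apply: (bfV (c := 1)) => //.
  by apply: bfD; [exact: bf_vol|exact: bf_const].
by move=> t v _ _ _ _; rewrite lerDr vol_ge0.
Qed.

Lemma volE t v : 0 < t -> t < t0 -> 0 < v -> v <= 1 ->
  vol t v = 1 + t * vol_rem t v.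
Proof.
move=> t1 t2 v0 v1.
have v2 : vol t v ^+ 2 = dens t v ^+ n.
  by rewrite sqr_sqrtr// exprn_ge0// ltW// dens_gt0.
have den : vol t v + 1 != 0 by rewrite gt_eqF// ltr_wpDl// vol_ge0.
apply: (mulIf den); rewrite /vol_rem mulrDl mul1r.
rewrite (_ : t * _ * _ = (t * P.[v]) * \sum_(i < n) dens t v ^+ i); last by field.
have -> : t * P.[v] = dens t v - 1 by rewrite /dens; ring.
by rewrite -subrX1 -v2; ring.
Qed.

(** A crude bound, from D >= 1/2 and sqrt(2^-n) >= 2^-n; it keeps the total volume away from 0 when
    averages are formed. *)
Lemma vol_ge t v : 0 < t -> t < t0 -> 0 < v -> v <= 1 -> 2^-1 ^+ n <= vol t v.
Proof.
move=> t1 t2 v0 v1; have h : (0 : R) <= 2^-1 by lra.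
rewrite /vol -[leLHS]ger0_norm ?exprn_ge0// -sqrtr_sqr ler_wsqrtr//.
apply: (@le_trans _ _ (2^-1 ^+ n)).
  by rewrite expr2 ler_piMr ?exprn_ge0// exprn_ile1//; lra.
by rewrite lerXn2r ?nnegrE ?(dens_ge t1 t2 v0 v1)// ltW// dens_gt0.
Qed.

Lemma wint_bf_bound (phi : R -> R -> R) : bf phi ->
  exists2 K, 0 <= K & forall t, 0 < t -> t < t0 -> `|wint n (phi t)| <= K.
Proof.
move=> pb; have [mp [K K0 pK]] := pb.
exists (K * wint n (fun=> 1 : R)).
  by rewrite mulr_ge0// wint_ge0.
move=> t t1 t2; apply: wint_norm_le; first exact: bf_bounded01 pb t1 t2.
by move=> v; exact: pK.
Qed.

(* The O(t^3) error absorbs both the remainder X and the change of volume. *)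
Lemma quadratic_expansion (a : {poly R}) (X : R -> R -> R) : bf X ->
  exists2 K, 0 <= K & forall t, 0 < t -> t < t0 ->
    `|wint n (fun v => (t * (a.[v] + t * X t v)) ^+ 2 * vol t v)
      - t ^+ 2 * wint n (horner (a ^+ 2))| <= K * t ^+ 3.
Proof.
move=> bX.
(* The coefficient of t^3: the first two terms come from (a + tX)^2 - a^2, the last from vol - 1 = t
   [vol_rem]. *)
pose N t v := 2 * a.[v] * X t v + t * X t v ^+ 2
  + (a.[v] + t * X t v) ^+ 2 * vol_rem t v.
have bN : bf N.
  have ba := bf_poly t0 a.
  have btX : bf (fun t v => t * X t v) by apply: bfM => //; exact: bf_t.
  apply: bfD.
    apply: bfD; first by apply: bfM => //; apply: bfM => //; exact: bf_const.
    by apply: bfM; [exact: bf_t|exact: bfX].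
  by apply: bfM; [apply: bfX; exact: bfD|exact: bf_vol_rem].
have [K K0 NK] := wint_bf_bound bN; exists K => // t t1 t2.
have bNt := bf_bounded01 bN t1 t2.
have ba2 := bounded01_poly (a ^+ 2).
have -> : wint n (fun v => (t * (a.[v] + t * X t v)) ^+ 2 * vol t v) =
    t ^+ 2 * wint n (horner (a ^+ 2)) + t ^+ 3 * wint n (N t).
  rewrite -!wintZ// -wintD; try exact: bounded01Z.
  apply: eq_wint => v v0 v1; rewrite volE// /N horner_exp; ring.
rewrite addrAC subrr add0r normrM ger0_norm ?exprn_ge0 ?(ltW t1)// mulrC.
by rewrite ler_wpM2r ?NK// exprn_ge0// ltW.
Qed.

Section traceless.

(** For f = P(u), v(1-v)P'' is the radial minus the tangential eigenvalue of the Hessian on the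
    round sphere, so this is the corresponding difference for -(n-2)/2 Hess0 f. *)
Definition traceless_poly : {poly R} :=
  (- (n%:R - 2) / 2) *: ('X * (1 - 'X) * P^`()^`()).

(** The radial minus the tangential eigenvalue of Ric relative to g_t; the squared norm of the
    trace-free part is (1 - 1/n) times its square. *)
Definition traceless_fun (t v : R) : R :=
  ric_rad n (conf_poly P t) v * ((1 - v) / v) / (conf_poly P t).[v].

Lemma traceless_expansion : exists2 X, bf X &
  forall t v, 0 < t -> t < t0 -> 0 < v -> v <= 1 ->
    traceless_fun t v = t * (traceless_poly.[v] + t * X t v).
Proof.
(* With q = [qlog] and D = [dens], q^2 - 2 [dqlog] = 3 q^2 - 2tP''/D. The leading term replaces
   1/D^2 by 1, and 1 - 1/D^2 is divisible by t. *)
pose Y t v := ((n%:R - 2) / 4) * (v * (1 - v)) *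
  (4 * P.[v] * P^`()^`().[v] * (dens t v)^-1
   - 2 * t * P.[v] ^+ 2 * P^`()^`().[v] * (dens t v)^-1 ^+ 2
   + 3 * P^`().[v] ^+ 2 * (dens t v)^-1 ^+ 3).
have bY : bf Y.
  have b2 := bf_poly t0 P^`()^`(); have b1 := bf_poly t0 P^`().
  have b0 := bf_poly t0 P; have bi := bf_dens_inv; have bt := bf_t t0.
  have bv := bf_id t0; have bc (c : R) := bf_const t0 c.
  apply: bfM.
    by apply: bfM => //; apply: bfM => //; apply: bfB.
  apply: bfD; last by apply: bfM; [apply: bfM => //; exact: bfX|exact: bfX].
  apply: bfB; first by apply: bfM => //; apply: bfM => //; exact: bfM.
  apply: bfM; last exact: bfX.
  by apply: bfM => //; apply: bfM; [exact: bfM|exact: bfX].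
exists Y => // t v t1 t2 v0 v1.
have D0 : dens t v != 0 by rewrite gt_eqF// dens_gt0.
rewrite /traceless_fun conf_traceless; [|by rewrite gt_eqF|exact: D0].
rewrite /traceless_poly /Y /dqlog /qlog -/(dens t v) !hornerE /=.
move: D0; rewrite /dens.
by move: (P.[v]) (P^`().[v]) (P^`()^`().[v]) => p p1 p2 D0; field.
Qed.

End traceless.

Section scalar.
Variable lam : R.
Hypotheses (P_jacobi : jacobi n P lam) (wintP : wint n (horner P) = 0).
Hypothesis wint1_gt0 : 0 < wint n (fun=> 1 : R).

Local Notation c := ((n%:R - 1) * (lam - n%:R)).

Definition scal_avg (t : R) : R :=
  (wint n (vol t))^-1 * wint n (fun v => scal n (conf_poly P t) v * vol t v).

Definition scal_fun (t v : R) : R := scal n (conf_poly P t) v.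

Lemma bf_scal_rem : bf (scal_rem n P ^~ lam).
Proof.
have b1 := bf_poly t0 P^`(); have b0 := bf_poly t0 P; have bi := bf_dens_inv.
have bt := bf_t t0; have bv := bf_id t0; have bc (d : R) := bf_const t0 d.
have bi2 : bf (fun t v => (dens t v ^+ 2)^-1).
  under eq_fun do under eq_fun do rewrite -exprVn; exact: bfX.
have bi3 : bf (fun t v => (dens t v ^+ 3)^-1).
  under eq_fun do under eq_fun do rewrite -exprVn; exact: bfX.
apply: bfM => //; apply: bfD.
  apply: bfB.
    by apply: bfM => //; apply: bfM => //; exact: bfX.
  apply: bfM => //; apply: bfM.
    by apply: bfM => //; exact: bfX.
  by apply: bfD => //; exact: bfM.
apply: bfM => //; apply: bfM; last exact: bfX.
by apply: bfM; [exact: bfM|exact: bfB].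
Qed.

Lemma scal_funE t v : 0 < t -> t < t0 -> 0 < v -> v <= 1 ->
  scal_fun t v = n%:R * (n%:R - 1) + t * (c * P.[v] + t * scal_rem n P t lam v).
Proof.
move=> t1 t2 v0 v1; rewrite /scal_fun (conf_scal_expansion P_jacobi).
- by ring.
- by rewrite gt_eqF.
- by rewrite gt_eqF// (dens_gt0 t1 t2).
Qed.

(** The first-order term of the average is a multiple of the integral of P, which vanishes. Hence
    subtracting Rbar or n(n-1) gives the same leading term. *)
Lemma scal_avg_expansion : exists2 rho : R -> R,
  (exists K : R, forall t, 0 < t -> t < t0 -> `|rho t| <= K) &
  (forall t, 0 < t -> t < t0 ->
    scal_avg t = n%:R * (n%:R - 1) + t ^+ 2 * rho t).
Proof.
pose Z t v := c * P.[v] * vol_rem t v + scal_rem n P t lam v * vol t v.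
have bZ : bf Z.
  apply: bfD; last by apply: bfM; [exact: bf_scal_rem|exact: bf_vol].
  apply: bfM; last exact: bf_vol_rem.
  by apply: bfM; [exact: bf_const|exact: bf_poly].
have [K K0 ZK] := wint_bf_bound bZ.
pose m := 2^-1 ^+ n * wint n (fun=> 1 : R).
have m0 : 0 < m by rewrite mulr_gt0// exprn_gt0//; lra.
have vol_m t : 0 < t -> t < t0 -> m <= wint n (vol t).
  move=> t1 t2; rewrite /m -wintZ; last exact: bounded01_cst.
  apply: le_wint.
  - by have := bounded01_cst (2^-1 ^+ n * 1 : R).
  - exact: bf_bounded01 bf_vol t1 t2.
  - by move=> v v0 v1; rewrite mulr1 vol_ge.
exists (fun t => (wint n (vol t))^-1 * wint n (Z t)).
  exists (m^-1 * K) => t t1 t2; rewrite normrM; apply: ler_pM => //; last exact: ZK.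
  have w0 := lt_le_trans m0 (vol_m t t1 t2).
  by rewrite gtr0_norm ?invr_gt0// lef_pV2 ?posrE// vol_m.
move=> t t1 t2; have w0 := lt_le_trans m0 (vol_m t t1 t2).
apply: (mulfI (lt0r_neq0 w0)); rewrite /scal_avg mulrA divff ?lt0r_neq0// mul1r.
rewrite (_ : wint n (vol t) * (_ + _) =
  wint n (vol t) * (n%:R * (n%:R - 1)) + t ^+ 2 * wint n (Z t)); last first.
  by field; exact: lt0r_neq0.
have bvt := bf_bounded01 bf_vol t1 t2; have bZt := bf_bounded01 bZ t1 t2.
have bP := bounded01_poly P.
have -> : wint n (fun v => scal n (conf_poly P t) v * vol t v) =
    n%:R * (n%:R - 1) * wint n (vol t) + (t * c * wint n (horner P)
      + t ^+ 2 * wint n (Z t)).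
  rewrite -!wintZ// -wintD; try exact: bounded01Z.
  rewrite -wintD; [|exact: bounded01Z|]; last by apply: bounded01D; exact: bounded01Z.
  apply: eq_wint => v v0 v1; rewrite -/(scal_fun t v) scal_funE//.
  by rewrite /Z [X in _ * X = _]volE// mulrDl; rewrite volE//; ring.
by rewrite wintP; ring.
Qed.

Lemma scalar_expansion : exists2 X, bf X &
  forall t v, 0 < t -> t < t0 -> 0 < v -> v <= 1 ->
    scal_fun t v - scal_avg t = t * ((c *: P).[v] + t * X t v).
Proof.
have [rho [L rhoL] rhoE] := scal_avg_expansion.
exists (fun t v => scal_rem n P t lam v - rho t).
  by apply: bfB; [exact: bf_scal_rem|exact: (bf_cst rhoL)].
by move=> t v t1 t2 v0 v1; rewrite scal_funE// rhoE// hornerZ; ring.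
Qed.

End scalar.

End expansion.

(** * Integral identities for the eigenfunction *)

Section jacobi_integrals.
Context (R : realType) (n : nat) (P : {poly R}) (lam : R).
Hypotheses (n_gt0 : (0 < n)%N) (P_jacobi : jacobi n P lam).

(** Differentiating the equation: P' solves the same equation in dimension n + 2 with eigenvalue lam
    - n. *)
Lemma jacobi_deriv v :
  v * (1 - v) * P^`()^`()^`().[v] + (1 + n%:R / 2) * (1 - 2 * v) * P^`()^`().[v]
  = (n%:R - lam) * P^`().[v].
Proof.
pose L := 'X * (1 - 'X) * P^`()^`() + (n%:R / 2) *: ((1 - 2 *: 'X) * P^`()).
have E : horner L = horner (- lam *: P).
  by apply/funext => y; rewrite [RHS]hornerZ -P_jacobi /L !hornerE /=; ring.
have := congr1 (fun f : R -> R => (f^`())%classic v) E.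
rewrite -!derivE /L !(derivD, derivM, derivN, derivZ, derivX, derivC) !hornerE /= => H.
have -> : (n%:R - lam) * P^`().[v] = - lam * P^`().[v] + n%:R * P^`().[v] by ring.
by rewrite -H; field.
Qed.

(** [wint_divergence] with V = P', whose integrand is -lam P. *)
Lemma wint_jacobi : lam != 0 -> wint n (horner P) = 0.
Proof.
move=> lam0; have := wint_divergence P^`() n_gt0.
rewrite (_ : wint n _ = wint n (fun v => - lam * P.[v])); last first.
  by apply: eq_wint => v _ _; exact: P_jacobi.
rewrite wintZ; last exact: bounded01_poly.
by move/eqP; rewrite mulf_eq0 oppr_eq0 (negbTE lam0) => /eqP.
Qed.

Local Notation dirichlet p := ('X * (1 - 'X) * p ^+ 2).

Lemma wint_subZ (p q : {poly R}) a :
  wint n (fun v => p.[v] - a * q.[v]) = wint n (horner p) - a * wint n (horner q).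
Proof.
rewrite -mulNr -wintZ; last exact: bounded01_poly.
rewrite -wintD; [|exact: bounded01_poly|].
  by apply: eq_wint => v _ _; rewrite mulNr.
have := bounded01_poly (- a *: q); rewrite (_ : horner _ = fun v => - a * q.[v])//.
by apply/funext => v; rewrite hornerZ.
Qed.

(** Green's identity, obtained with V = P P'; on the round sphere |grad f|^2 = u(1-u) P'^2. *)
Lemma wint_gradient : wint n (horner (dirichlet P^`())) = lam * wint n (horner (P ^+ 2)).
Proof.
apply/eqP; rewrite -subr_eq0 -wint_subZ; apply/eqP.
rewrite -(wint_divergence (P * P^`()) n_gt0); apply: eq_wint => v _ _.
rewrite derivM !hornerE /=.
transitivity (v * (1 - v) * P^`().[v] ^+ 2 + P.[v] * (- lam * P.[v])); first by ring.
by rewrite -P_jacobi; ring.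
Qed.

(** [wint_divergence] with V = v(1-v) P' P''; the third derivative disappears through
    [jacobi_deriv]. This takes the place of the integrated Bochner formula. *)
Lemma wint_hessian : wint n (horner (('X * (1 - 'X) * P^`()^`()) ^+ 2)) =
  (lam - n%:R) * wint n (horner (dirichlet P^`())).
Proof.
apply/eqP; rewrite -subr_eq0 -wint_subZ; apply/eqP.
rewrite -(wint_divergence ('X * (1 - 'X) * (P^`() * P^`()^`())) n_gt0).
apply: eq_wint => v _ _.
rewrite !(derivM, derivD, derivN, derivX, derivC) !hornerE /=.
transitivity ((v * (1 - v) * P^`()^`().[v]) ^+ 2
  + v * (1 - v) * P^`().[v] * ((n%:R - lam) * P^`().[v])); first by ring.
by rewrite -jacobi_deriv; field.
Qed.

End jacobi_integrals.

(** * The curvature energies as integrals in u *)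

Section energies.
Context (R : realType) (n : nat) (P : {poly R}) (t0 : R).
Hypothesis n_gt0 : (0 < n)%N.
Hypothesis t0P : forall t v, 0 < t -> t < t0 -> 0 < v -> v <= 1 ->
  `|t * P.[v]| <= 2^-1.
Variable t : R.
Hypotheses (t_gt0 : 0 < t) (t_lt : t < t0).
Local Notation h := (@radial_metric R n (conf_poly P t)).
Local Notation u := (@sphere_u R n).

Lemma conf_poly_gt0 v : 0 < v -> v <= 1 -> 0 < (conf_poly P t).[v].
Proof.
move=> v0 v1; rewrite conf_polyE mulr_gt0 ?(dens_gt0 t0P)//.
by rewrite mulr_gt0// exprn_gt0.
Qed.

Lemma sphere_u_row (s : n.-tuple R) : u (row_of_tuple s) = tuple_u s.
Proof.
rewrite /sphere_u /tuple_u; congr (_ + _)^-1.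
by rewrite /dot /tuple_sq; apply: eq_bigr => i _; rewrite mxE expr2.
Qed.

Lemma volume_integral_radial (G : 'rV[R]_n -> R) (phi : R -> R) :
  (forall x, G x = phi (u x)) -> bounded01 (fun v => phi v * vol n P t v) ->
  volume_integral h G = 2 ^+ n * wint n (fun v => phi v * vol n P t v).
Proof.
move=> GE pb; rewrite -wintZ//; apply: eq_Rintegral => s _.
rewrite GE sphere_u_row det_radial conf_polyE sphere_u_row.
have v0 := tuple_u_gt0 s; have v1 := tuple_u_le1 s; set v := tuple_u s in v0 v1 *.
rewrite (_ : 4 * v ^+ 2 = (2 * v) ^+ 2); last by ring.
rewrite exprMn sqrtrM; last by rewrite exprn_ge0// sqr_ge0.
rewrite exprAC sqrtr_sqr ger0_norm; last by rewrite exprn_ge0// mulr_ge0// ltW.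
by rewrite exprMn /vol /dens; ring.
Qed.

Lemma scalar_curvature_conf (x : 'rV[R]_n) :
  scalar_curvature h x = scal_fun n P t (u x).
Proof. exact: (scalar_curvature_radial conf_poly_gt0). Qed.

Lemma norm_sq_ricci_conf (x : 'rV[R]_n) r :
  tensor_norm_sq h x (ricci h x - (r / n%:R) *: h x) =
  (1 - n%:R^-1) * traceless_fun n P t (u x) ^+ 2
  + (scal_fun n P t (u x) - r) ^+ 2 / n%:R.
Proof. exact: (norm_sq_ricci_sub conf_poly_gt0). Qed.

Local Notation bf := (bounded_family t0).

Variables (lam : R) (X Z : R -> R -> R).
Hypotheses (bX : bf X) (bZ : bf Z).
Local Notation c := ((n%:R - 1) * (lam - n%:R)).
Hypothesis tracelessE : forall v, 0 < v -> v <= 1 ->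
  traceless_fun n P t v = t * ((traceless_poly n P).[v] + t * X t v).
Hypothesis scalE : forall v, 0 < v -> v <= 1 ->
  scal_fun n P t v - scal_avg n P t = t * ((c *: P).[v] + t * Z t v).

Let bf_dev (p : {poly R}) (Y : R -> R -> R) : bf Y ->
  bf (fun t v => (t * (p.[v] + t * Y t v)) ^+ 2 * vol n P t v).
Proof.
move=> bY; apply: bfM; last exact: bf_vol.
by apply: bfX; apply: bfM; [exact: bf_t|];
   apply: bfD; [exact: bf_poly|apply: bfM; [exact: bf_t|]].
Qed.

Definition traceless_int : R := wint n (fun v =>
  (t * ((traceless_poly n P).[v] + t * X t v)) ^+ 2 * vol n P t v).

Definition scalar_int : R := wint n (fun v =>
  (t * ((c *: P).[v] + t * Z t v)) ^+ 2 * vol n P t v).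

Lemma average_conf : average h (scalar_curvature h) = scal_avg n P t.
Proof.
have bvt := bf_bounded01 (bf_vol n P t0) t_gt0 t_lt.
have e2 : 2 ^+ n != 0 :> R by rewrite expf_neq0.
rewrite /average (@volume_integral_radial _ (fun=> 1))//; last first.
  by under eq_fun do rewrite mul1r.
(* The scalar curvature is replaced by its expansion, whose boundedness on (0, 1], and hence
   integrability, is immediate. *)
pose phi v := scal_avg n P t + t * ((c *: P).[v] + t * Z t v).
have phiE v : 0 < v -> v <= 1 -> scal_fun n P t v = phi v.
  by move=> v0 v1; rewrite /phi -scalE// addrC subrK.
rewrite (@volume_integral_radial _ phi); last 2 first.
- by move=> x; rewrite scalar_curvature_conf phiE ?u_gt0 ?u_le1.
- have bphi : bf (fun t' v =>
      (scal_avg n P t + t' * ((c *: P).[v] + t' * Z t' v)) * vol n P t' v).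
    apply: bfM; last exact: bf_vol.
    apply: bfD; first exact: bf_const.
    by apply: bfM; [exact: bf_t|];
      apply: bfD; [exact: bf_poly|apply: bfM; [exact: bf_t|]].
  exact: bf_bounded01 bphi t_gt0 t_lt.
rewrite invfM mulrACA mulVf// mul1r /scal_avg; congr (_^-1 * _).
  by apply: eq_wint => v _ _; rewrite mul1r.
by apply: eq_wint => v v0 v1; rewrite -phiE.
Qed.

Lemma traceless_energy_conf :
  volume_integral h (fun x => tensor_norm_sq h x
    (ricci h x - (scalar_curvature h x / n%:R) *: h x)) =
  2 ^+ n * ((1 - n%:R^-1) * traceless_int).
Proof.
have bt := bf_bounded01 (bf_dev (traceless_poly n P) bX) t_gt0 t_lt.
rewrite /traceless_int -wintZ//.
rewrite (@volume_integral_radial _ (fun v =>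
  (1 - n%:R^-1) * (t * ((traceless_poly n P).[v] + t * X t v)) ^+ 2)).
- by congr (_ * _); apply: eq_wint => v v0 v1; rewrite -mulrA.
- move=> x; rewrite norm_sq_ricci_conf scalar_curvature_conf subrr expr0n /=.
  by rewrite mul0r addr0 tracelessE ?u_gt0 ?u_le1.
- by under eq_fun do rewrite -mulrA; exact: bounded01Z.
Qed.

Lemma scalar_deviation_conf :
  volume_integral h (fun x =>
    (scalar_curvature h x - average h (scalar_curvature h)) ^+ 2) =
  2 ^+ n * scalar_int.
Proof.
have bs := bf_bounded01 (bf_dev (c *: P) bZ) t_gt0 t_lt.
apply: volume_integral_radial bs => x.
by rewrite average_conf scalar_curvature_conf scalE ?u_gt0 ?u_le1.
Qed.

Lemma einstein_deviation_conf :
  volume_integral h (fun x => tensor_norm_sq h x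
    (ricci h x - (average h (scalar_curvature h) / n%:R) *: h x)) =
  2 ^+ n * ((1 - n%:R^-1) * traceless_int + n%:R^-1 * scalar_int).
Proof.
have bt := bf_bounded01 (bf_dev (traceless_poly n P) bX) t_gt0 t_lt.
have bs := bf_bounded01 (bf_dev (c *: P) bZ) t_gt0 t_lt.
rewrite /traceless_int /scalar_int -!wintZ// -wintD; try exact: bounded01Z.
rewrite (@volume_integral_radial _ (fun v =>
  (1 - n%:R^-1) * (t * ((traceless_poly n P).[v] + t * X t v)) ^+ 2
  + n%:R^-1 * (t * ((c *: P).[v] + t * Z t v)) ^+ 2)).
- by congr (_ * _); apply: eq_wint => v v0 v1; rewrite mulrDl -!mulrA.
- move=> x; rewrite norm_sq_ricci_conf average_conf.
  by rewrite tracelessE ?scalE ?u_gt0 ?u_le1// [_ / n%:R]mulrC.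
- have := bounded01D (bounded01Z (1 - n%:R^-1) bt) (bounded01Z n%:R^-1 bs).
  by congr bounded01; apply/funext => v; ring.
Qed.

End energies.

(** Lagrange's identity: the sum of the squares of x_i v_j - x_j v_i over all i, j is twice the
    difference of the two sides. *)
Lemma dot_sqr_le (R : realType) n (x v : 'rV[R]_n) :
  dot x v ^+ 2 <= dot x x * dot v v.
Proof.
have : 0 <= \sum_i \sum_j (x 0 i * v 0 j - x 0 j * v 0 i) ^+ 2.
  by apply: sumr_ge0 => i _; apply: sumr_ge0 => j _; exact: sqr_ge0.
have e i : \sum_j (x 0 i * v 0 j - x 0 j * v 0 i) ^+ 2 =
    dot v v * (x 0 i * x 0 i) + dot x x * (v 0 i * v 0 i)
    - 2 * dot x v * (x 0 i * v 0 i).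
  transitivity (\sum_j (x 0 i * x 0 i * (v 0 j * v 0 j)
    + v 0 i * v 0 i * (x 0 j * x 0 j) + - 2 * (x 0 i * v 0 i) * (x 0 j * v 0 j))).
    by apply: eq_bigr => j _; ring.
  by rewrite !big_split /= -!mulr_sumr -/(dot x x) -/(dot v v) -/(dot x v); ring.
under eq_bigr do rewrite e.
rewrite sumrB big_split /= -!mulr_sumr -/(dot x x) -/(dot v v) -/(dot x v).
set a := dot x x; set b := dot v v; set d := dot x v => H.
have {}H : 0 <= 2 * (a * b - d ^+ 2).
  by rewrite (_ : _ * _ = b * a + a * b - 2 * d * d)//; ring.
by rewrite -subr_ge0; move: H; rewrite pmulr_rge0.
Qed.

Lemma asymptotic_lt (R : realType) (A S : R -> R) (a s C K L t0 : R) :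
  0 < t0 -> 0 <= K -> 0 <= L -> C * a < s ->
  (forall t, 0 < t -> t < t0 -> `|A t - t ^+ 2 * a| <= K * t ^+ 3) ->
  (forall t, 0 < t -> t < t0 -> `|S t - t ^+ 2 * s| <= L * t ^+ 3) ->
  exists t1, [/\ 0 < t1, t1 <= t0 & forall t, 0 < t -> t < t1 -> C * A t < S t].
Proof.
move=> t0_gt0 K0 L0 Cas HA HS.
(* C may be negative, hence the absolute value in the combined error constant; the summand 1 keeps
   the divisor positive. *)
pose M := `|C| * K + L + 1.
have M0 : 0 < M by rewrite ltr_wpDl// addr_ge0// mulr_ge0.
have gap : 0 < s - C * a by rewrite subr_gt0.
exists (Num.min t0 ((s - C * a) / M)); split.
- by rewrite lt_min t0_gt0 divr_gt0.
- by rewrite ge_min lexx.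
move=> t tp; rewrite lt_min => /andP[tt0]; rewrite ltr_pdivlMr// => tM.
have := HA t tp tt0; have := HS t tp tt0.
rewrite !ler_norml => /andP[S1 _] A1.
have CA : C * (A t - t ^+ 2 * a) <= `|C| * K * t ^+ 3.
  rewrite (le_trans (ler_norm _))// normrM -mulrA ler_wpM2l// ler_norml.
  exact: A1.
have t2 : 0 < t ^+ 2 by rewrite exprn_gt0.
have E : t ^+ 2 * (t * M) < t ^+ 2 * (s - C * a) by rewrite ltr_pM2l.
have t3 : 0 < t ^+ 3 by rewrite exprn_gt0.
have e1 : t ^+ 2 * (t * M) = `|C| * K * t ^+ 3 + L * t ^+ 3 + t ^+ 3.
  by rewrite /M; ring.
rewrite e1 in E.
have e2 : C * (A t - t ^+ 2 * a) = C * A t - t ^+ 2 * (C * a) by ring.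
rewrite e2 in CA.
have e3 : t ^+ 2 * (s - C * a) = t ^+ 2 * s - t ^+ 2 * (C * a) by ring.
rewrite e3 in E.
by move: (`|C| * K * t ^+ 3) (L * t ^+ 3) (t ^+ 3) (t ^+ 2 * s)
  (t ^+ 2 * (C * a)) (C * A t) (S t) S1 CA E t3 => *; lra.
Qed.

(** * Ricci curvature for small t *)

Section small_deformation.
Context (R : realType) (n : nat) (P : {poly R}) (M : R).
Hypotheses (n_ge3 : (3 <= n)%N) (M_ge1 : 1 <= M).
Hypothesis P_le : forall v, 0 <= v -> v <= 1 ->
  [/\ `|P.[v]| <= M, `|P^`().[v]| <= M & `|P^`()^`().[v]| <= M].

(** Below this value tP, tP' and tP'' are at most 1/8 in absolute value, so 1 + tP >= 1/2, |[qlog]|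
    <= 1/4 and |[dqlog]| <= 1/2. These bounds suffice in every dimension n >= 3. *)
Definition small_t : R := (8 * M)^-1.

Let M_gt0 : 0 < M. Proof. exact: lt_le_trans M_ge1. Qed.

Lemma small_t_gt0 : 0 < small_t. Proof. by rewrite invr_gt0 mulr_gt0. Qed.

Let tM t : 0 < t -> t < small_t -> t * M <= 8^-1.
Proof.
move=> t0; rewrite /small_t invfM => /ltW.
by rewrite -ler_pdivlMr// mulrC.
Qed.

Let scaled t (a : R) : 0 < t -> t < small_t -> `|a| <= M -> `|t * a| <= 8^-1.
Proof.
move=> t0 ts aM; rewrite normrM gtr0_norm// (le_trans _ (tM t0 ts))//.
by rewrite ler_wpM2l// ltW.
Qed.

Lemma small_dens t v : 0 < t -> t < small_t -> 0 < v -> v <= 1 ->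
  `|t * P.[v]| <= 2^-1.
Proof.
move=> t0 ts v0 v1; have [p0 _ _] := P_le (ltW v0) v1.
by rewrite (le_trans (scaled t0 ts p0))//; lra.
Qed.

Lemma small_qlog t v : 0 < t -> t < small_t -> 0 < v -> v <= 1 ->
  `|qlog P t v| <= 4^-1 /\ `|dqlog P t v| <= 2^-1.
Proof.
move=> t0 ts v0 v1; have [_ p1 p2] := P_le (ltW v0) v1.
have D := dens_ge small_dens t0 ts v0 v1.
have D0 : 0 < dens P t v by apply: lt_le_trans D; lra.
have q a : `|a| <= M -> `|t * a / dens P t v| <= 4^-1.
  move=> aM; rewrite normrM normfV (gtr0_norm D0) ler_pdivrMr//.
  rewrite (le_trans (scaled t0 ts aM))//; lra.
have q1 := q _ p1; have q2 := q _ p2; split; first exact: q1.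
rewrite /dqlog (le_trans (ler_normB _ _))// normrX /qlog -/(dens P t v).
have : `|t * P^`().[v] / dens P t v| ^+ 2 <= 4^-1 ^+ 2.
  by rewrite lerXn2r ?nnegrE//; lra.
move: q2; rewrite -/(dens P t v).
by move: (`|_|) (`|_| ^+ 2) => x y; rewrite [4^-1 ^+ 2]expr2; lra.
Qed.

(** These are the tangential and the radial eigenvalue of the matrix of Ric. After division by v^2
    the constant term 4(n-1) dominates everything else; in the radial one the terms in [qlog]^2
    cancel and all the others carry the factor n - 1. *)
Lemma small_ricci t v : 0 < t -> t < small_t -> 0 < v -> v <= 1 ->
  0 <= ric_iso n (conf_poly P t) v /\
  0 <= ric_iso n (conf_poly P t) v + ric_rad n (conf_poly P t) v * ((1 - v) / v).
Proof.
move=> t0 ts v0 v1.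
have vn0 : v != 0 by rewrite gt_eqF.
have Dn0 : 1 + t * P.[v] != 0 by rewrite gt_eqF// (dens_gt0 small_dens).
rewrite conf_ric_rad// conf_ric_iso//.
have [] := small_qlog t0 ts v0 v1.
move: (qlog P t v) (dqlog P t v) => q1 q2; rewrite !ler_norml.
move=> /andP[q1a q1b] /andP[q2a q2b].
have m3 : 3 <= n%:R :> R by rewrite ler_nat.
have w0 : 0 <= v * (1 - v) by rewrite mulr_ge0 ?subr_ge0// ltW.
have w1 : v * (1 - v) <= 1 by rewrite -[leRHS]mul1r ler_pM ?subr_ge0 ?(ltW v0)// gerBl ltW.
have b1 : `|(2 * v - 1) * q1| <= 4^-1.
  rewrite normrM -[leRHS]mul1r ler_pM//; rewrite ler_norml; apply/andP; split; lra.
have b2 : `|v * (1 - v) * q2| <= 2^-1.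
  by rewrite normrM -[leRHS]mul1r ler_pM// ler_norml; apply/andP; split; lra.
have b3 : v * (1 - v) * q1 ^+ 2 <= 4^-1.
  rewrite -[leRHS]mul1r ler_pM ?sqr_ge0//.
  have : `|q1| ^+ 2 <= 4^-1 ^+ 2.
    by rewrite lerXn2r ?nnegrE// ler_norml; apply/andP; split; lra.
  by rewrite -normrX ger0_norm ?sqr_ge0// => /le_trans; apply; rewrite expr2; lra.
move: b1 b2; rewrite !ler_norml => /andP[b1a b1b] /andP[b2a b2b].
have m1 : 0 <= n%:R - 1 :> R by lra.
have m2 : 0 <= n%:R - 2 :> R by lra.
have c1 := ler_wpM2l m1 b1a.
have c3 := ler_wpM2l m2 b3.
have c2 := ler_wpM2l m1 b2b.
split.
  apply: mulr_ge0; first exact: sqr_ge0.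
  rewrite (_ : _ - _ = 4 * (n%:R - 1) + 2 * ((n%:R - 1) * ((2 * v - 1) * q1))
    - 2 * (v * (1 - v) * q2) - (n%:R - 2) * (v * (1 - v) * q1 ^+ 2)); last by ring.
  move: c1 c3 b2b; move: (_ * (_ * q1)) (_ * (_ * q1 ^+ 2)) (v * (1 - v) * q2).
  by move=> *; lra.
rewrite (_ : _ + _ = v ^+ 2 * (2 * (2 * (n%:R - 1)
  + (n%:R - 1) * ((2 * v - 1) * q1) - (n%:R - 1) * (v * (1 - v) * q2)))); last by field.
apply: mulr_ge0; first exact: sqr_ge0.
move: c1 c2; move: (_ * (_ * q1)) (_ * (_ * q2)) => x y.
by move=> *; lra.
Qed.

(** The quadratic form is iso |v|^2 + rad (x.v)^2. For negative rad, Cauchy-Schwarz bounds it below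
    by the radial eigenvalue times |v|^2. *)
Lemma radial_ricci_ge0 t (x v : 'rV[R]_n) : 0 < t -> t < small_t ->
  0 <= \sum_i \sum_j
    ricci (radial_metric (conf_poly P t)) x i j * v 0 i * v 0 j.
Proof.
move=> t0 ts; have u0 := u_gt0 x; have u1 := u_le1 x.
have Fpos w : 0 < w -> w <= 1 -> 0 < (conf_poly P t).[w].
  exact: conf_poly_gt0 small_dens _ t0 ts w.
have [] := small_ricci t0 ts u0 u1; rewrite -dotE.
set iso := ric_iso _ _ _; set rad := ric_rad _ _ _ => iso0 isorad.
have e i : \sum_j ricci (radial_metric (conf_poly P t)) x i j * v 0 i * v 0 j =
    iso * (v 0 i * v 0 i) + rad * dot x v * (x 0 i * v 0 i).
  transitivity (\sum_j (kron i j * (iso * (v 0 i * v 0 j))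
    + rad * (x 0 i * v 0 i) * (x 0 j * v 0 j))).
    by apply: eq_bigr => j _; rewrite ricci_radial// -/iso -/rad; ring.
  by rewrite big_split /= sum_kron -mulr_sumr -/(dot x v); ring.
under eq_bigr do rewrite e.
rewrite big_split /= -!mulr_sumr -/(dot x v) -/(dot v v).
rewrite -mulrA -expr2; have vv := dot_ge0 v; have cs := dot_sqr_le x v.
have [rad0|/ltW rad0] := leP 0 rad.
  by rewrite addr_ge0// mulr_ge0// sqr_ge0.
apply: (@le_trans _ _ ((iso + rad * dot x x) * dot v v)); first exact: mulr_ge0.
by rewrite mulrDl lerD2l -mulrA ler_wnM2l.
Qed.

End small_deformation.

(** * Metric axioms for the deformed metric *)

Lemma dot_lin (R : realType) n a (u v w : 'rV[R]_n) :
  dot (a *: u + v) w = a * dot u w + dot v w.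
Proof.
by rewrite /dot mulr_sumr -big_split /=; apply: eq_bigr => i _; rewrite !mxE; ring.
Qed.

Lemma dotC (R : realType) n (u v : 'rV[R]_n) : dot u v = dot v u.
Proof. by apply: eq_bigr => i _; rewrite mulrC. Qed.

Lemma dot_gt0 (R : realType) n (u : 'rV[R]_n) : u != 0 -> 0 < dot u u.
Proof.
move=> u0; rewrite lt0r dot_ge0 andbT; apply: contraNneq u0 => uu.
apply/eqP/rowP => i; rewrite mxE; apply/eqP; rewrite -sqrf_eq0 expr2.
have := @psumr_eq0P R _ xpredT (fun i => u 0 i * u 0 i) _ uu i.
by move=> -> // j _; rewrite -expr2 sqr_ge0.
Qed.

Section conformal_metric.
Context (R : realType) (n : nat) (P : {poly R}) (t : R).
Hypothesis tP : forall v, 0 <= v -> v <= 1 -> `|t * P.[v]| <= 2^-1.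

Lemma sphere_coord_le1 (p : sphere R n) i : `|val p 0 i| <= 1.
Proof.
rewrite -(@ler_pXn2r _ 2)// ?nnegrE// expr1n -normrX ger0_norm ?sqr_ge0//.
have pp : dot (val p) (val p) = 1 by exact/eqP/(valP p).
rewrite -[leRHS]pp /dot (bigD1 i)//= -expr2 lerDl.
by apply: sumr_ge0 => j _; rewrite -expr2 sqr_ge0.
Qed.

(** Positivity concerns all points, including the pole omitted by the chart [false], where the
    argument of P is 0; this is why the bound on tP is assumed on the closed interval. *)
Lemma zonal_conformal_metric :
  is_riemannian_metric (conformal (fun p => 1 + t * zonal P p)
    (@round_metric R n)).
Proof.
split.
- by move=> p a u v w _ _ _; rewrite /conformal /round_metric dot_lin; ring.
- by move=> p u v _ _; rewrite /conformal /round_metric dotC.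
- move=> p u _ u0; rewrite /conformal /round_metric mulr_gt0 ?dot_gt0//.
  have := sphere_coord_le1 p (lshift n 0); rewrite ler_norml => /andP[p1 p2].
  have : `|t * zonal P p| <= 2^-1 by apply: tP; lra.
  by rewrite ler_norml => /andP[]; lra.
- move=> b i j; rewrite (@components_conformal _ _ _ _ (zonal_poly P b) t).
    rewrite (_ : (fun x => _) =
        (fun x => (conf_poly (zonal_poly P b) t *+ (i == j)).[sphere_u x])).
      exact: is_smooth_poly_u.
    by apply/funext => x; rewrite /radial_metric mxE hornerMn.
  by move=> x; rewrite zonal_chart.
Qed.

End conformal_metric.

(** * Choice of the constants and conclusion *)

Lemma zonal_poly_bound (R : realType) (P : {poly R}) :
  exists2 M : R, 1 <= M & forall b v, 0 <= v -> v <= 1 ->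
    [/\ `|(zonal_poly P b).[v]| <= M, `|(zonal_poly P b)^`().[v]| <= M &
        `|(zonal_poly P b)^`()^`().[v]| <= M].
Proof.
have [K0 K00 H0] := horner_bound P.
have [K1 K10 H1] := horner_bound P^`().
have [K2 K20 H2] := horner_bound P^`()^`().
exists (1 + K0 + K1 + K2); first by lra.
move=> b v v0 v1.
have w0 : 0 <= 1 - v by lra.
have w1 : 1 - v <= 1 by lra.
case: b => /=; last first.
  by split; [have := H0 v v0 v1|have := H1 v v0 v1|have := H2 v v0 v1]; lra.
have -> : (P \Po (1 - 'X))^`() = - (P^`() \Po (1 - 'X)).
  by rewrite deriv_comp derivB derivX derivC sub0r mulrN1.
have -> : (- (P^`() \Po (1 - 'X)))^`() = P^`()^`() \Po (1 - 'X).
  by rewrite derivN deriv_comp derivB derivX derivC sub0r mulrN1 opprK.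
rewrite hornerN normrN !horner_comp !hornerE /=.
by split; [have := H0 _ w0 w1|have := H1 _ w0 w1|have := H2 _ w0 w1]; lra.
Qed.

(** The second condition is affine in lam with slope d > 0, so it holds as soon as lam exceeds q =
    4n(n-1)n/d. *)
Lemma large_eigenvalue (R : realType) (n : nat) (C : R) : (3 <= n)%N ->
  C < 4 * n%:R * (n%:R - 1) / (n%:R - 2) ^+ 2 ->
  exists k : nat, let lam := k%:R * (k%:R + n%:R - 1) : R in
    n%:R < lam /\
    C * (n%:R - 2) ^+ 2 * lam < 4 * n%:R * (n%:R - 1) * (lam - n%:R).
Proof.
move=> n3; have m3 : 3 <= n%:R :> R by rewrite ler_nat.
have m2 : 0 < (n%:R - 2) ^+ 2 :> R by rewrite exprn_gt0//; lra.
rewrite ltr_pdivlMr// => HC.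
set d := 4 * n%:R * (n%:R - 1) - C * (n%:R - 2) ^+ 2.
have d0 : 0 < d by rewrite subr_gt0.
set q := 4 * n%:R * (n%:R - 1) * n%:R / d.
(* One successor already exceeds q; three of them also give k >= 3, whence lam >= k + n - 1 > n. *)
exists (Num.truncn q).+3; set k := _.+3; move=> lam.
have qk : q < k%:R.
  apply: (@lt_le_trans _ _ (Num.truncn q).+1%:R); first exact: truncnS_gt.
  by rewrite ler_nat /k ltnS (leq_trans (leqnSn _)).
have k3 : 3 <= k%:R :> R by rewrite ler_nat.
have k_lam : k%:R <= lam.
  rewrite /lam -[leLHS]mulr1 ler_wpM2l//; lra.
split.
  rewrite /lam (@lt_le_trans _ _ (1 * (k%:R + n%:R - 1)))//; first by lra.
  by rewrite ler_wpM2r//; lra.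
have : q < lam by apply: lt_le_trans k_lam.
rewrite /q ltr_pdivrMr// /d => H.
rewrite -subr_gt0 (_ : _ - _ = lam * (4 * n%:R * (n%:R - 1) - C * (n%:R - 2) ^+ 2)
  - 4 * n%:R * (n%:R - 1) * n%:R); last by ring.
by rewrite subr_gt0.
Qed.

(** The identity between the energies is kept next to the inequality so that both parts of the
    theorem follow from this one construction, applied to different constants. *)
Lemma zonal_deformation (R : realType) (n : nat) (C : R) : (3 <= n)%N ->
  C < 4 * n%:R * (n%:R - 1) / (n%:R - 2) ^+ 2 ->
  exists f : sphere R n -> R,
    is_laplace_eigenfunction round_metric f /\
    exists t0 : R, 0 < t0 /\
      forall t : R, 0 < t -> t < t0 ->
        let g := conformal (fun p => 1 + t * f p) round_metric in
        [/\ is_riemannian_metric g, nonneg_ricci g,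
            C * traceless_ricci_energy g < scalar_deviation g &
            einstein_deviation g =
              traceless_ricci_energy g + scalar_deviation g / n%:R].
Proof.
move=> n3 HC; have n0 : (0 < n)%N by exact: leq_trans n3.
have [k [lam_n HCk]] := large_eigenvalue n3 HC.
set lam := k%:R * _ in lam_n HCk.
have [P [J P1]] := jacobi_exists R n0 k; rewrite -/lam in J.
have [M M1 bM] := zonal_poly_bound P.
exists (zonal P); split; first exact: zonal_eigenfunction J P1.
have m3 : 3 <= n%:R :> R by rewrite ler_nat.
have lam0 : 0 < lam by lra.
have bMF := bM false; rewrite /= in bMF.
have tP := small_dens M1 bMF.
have wP := wint_jacobi n0 J (lt0r_neq0 lam0).
have w1 : 0 < wint n (fun=> 1 : R).
  have := @wint_pos R n 1; rewrite (_ : horner 1 = fun=> 1); last first.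
    by apply/funext => v; rewrite hornerE.
  by apply=> [v _ _|].
have [X bX XE] := traceless_expansion n tP.
have [Z bZ ZE] := scalar_expansion tP J wP w1.
pose W := wint n (horner (P ^+ 2)).
have W0 : 0 < W.
  apply: wint_pos => [v _ _|]; first by rewrite horner_exp sqr_ge0.
  by rewrite horner_exp P1 expr1n.
have [K K0 HK] := quadratic_expansion n tP (traceless_poly n P) bX.
have [L L0 HL] := quadratic_expansion n tP
  (((n%:R - 1) * (lam - n%:R)) *: P) bZ.
have wintZp (a : R) (p : {poly R}) :
    wint n (horner ((a *: p) ^+ 2)) = a ^+ 2 * wint n (horner (p ^+ 2)).
  rewrite -wintZ; last exact: bounded01_poly.
  by apply: eq_wint => v _ _; rewrite exprZn hornerZ.
have aE : wint n (horner (traceless_poly n P ^+ 2)) =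
    (n%:R - 2) ^+ 2 / 4 * ((lam - n%:R) * (lam * W)).
  rewrite /traceless_poly wintZp (wint_hessian n0 J) (wint_gradient n0 J) -/W.
  by field.
have sE : wint n (horner ((((n%:R - 1) * (lam - n%:R)) *: P) ^+ 2)) =
    ((n%:R - 1) * (lam - n%:R)) ^+ 2 * W by exact: wintZp.
have nn0 : n%:R != 0 :> R by lra.
have key : C * (1 - n%:R^-1) * wint n (horner (traceless_poly n P ^+ 2)) <
    wint n (horner ((((n%:R - 1) * (lam - n%:R)) *: P) ^+ 2)).
  rewrite aE sE.
  (* The positive factor that turns the inequality of [large_eigenvalue] into the one between the
     coefficients of t^2. *)
  pose fac := (n%:R - 1) / (4 * n%:R) * (lam - n%:R) * W.
  have fac0 : 0 < fac.
    by rewrite !mulr_gt0// ?invr_gt0 ?mulr_gt0//; lra.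
  have := HCk; rewrite -(ltr_pM2l fac0) => H.
  rewrite (_ : C * _ * _ = fac * (C * (n%:R - 2) ^+ 2 * lam)); last first.
    by rewrite /fac; field.
  rewrite (_ : _ ^+ 2 * W = fac * (4 * n%:R * (n%:R - 1) * (lam - n%:R)))//.
  by rewrite /fac; field.
have [t1 [t1_gt0 t1_le lt_t1]] :=
  asymptotic_lt (small_t_gt0 M1) K0 L0 key HK HL.
exists t1; split=> // t t_gt0 t_lt1 g.
have t_lt := lt_le_trans t_lt1 t1_le.
have gE b : components g b = radial_metric (conf_poly (zonal_poly P b) t).
  by apply: components_conformal => x; rewrite zonal_chart.
have gF : main_components g = radial_metric (conf_poly P t) by exact: gE.
have XE' v := XE t v t_gt0 t_lt.
have ZE' v := ZE t v t_gt0 t_lt.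
have eT : traceless_ricci_energy g =
    2 ^+ n * ((1 - n%:R^-1) * traceless_int n P t X).
  rewrite /traceless_ricci_energy gF.
  exact: (traceless_energy_conf n0 tP t_gt0 t_lt bX XE').
have eS : scalar_deviation g = 2 ^+ n * scalar_int n P t lam Z.
  rewrite /scalar_deviation gF.
  exact: (scalar_deviation_conf tP t_gt0 t_lt bZ ZE').
have eE : einstein_deviation g = 2 ^+ n * ((1 - n%:R^-1) * traceless_int n P t X
    + n%:R^-1 * scalar_int n P t lam Z).
  rewrite /einstein_deviation gF.
  exact: (einstein_deviation_conf n0 tP t_gt0 t_lt bX bZ XE' ZE').
split.
- apply: zonal_conformal_metric => v v0 v1.
  have [p0 _ _] := bMF v v0 v1.
  rewrite normrM gtr0_norm// (@le_trans _ _ (t * M))//.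
    by rewrite ler_wpM2l// ltW.
  have M0 : 0 < M by lra.
  move: t_lt; rewrite /small_t invfM => /ltW.
  by rewrite ler_pdivlMr// => H; lra.
- move=> b x v; rewrite gE.
  exact: (radial_ricci_ge0 n3 M1 (bM b) x v t_gt0 t_lt).
- rewrite eT eS mulrCA ltr_pM2l ?exprn_gt0// mulrA.
  exact: lt_t1.
- by rewrite eE eT eS; field.
Qed.

Theorem mainTheorem3 (R : realType) (n : nat) (hn : (3 <= n)%N) :
  (forall C : R, C < 4 * n%:R * (n%:R - 1) / (n%:R - 2) ^+ 2 ->
     exists f : sphere R n -> R,
       is_laplace_eigenfunction round_metric f /\
       exists t0 : R, 0 < t0 /\
         forall t : R, 0 < t -> t < t0 ->
           let g := conformal (fun p => 1 + t * f p) round_metric in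
           [/\ is_riemannian_metric g, nonneg_ricci g &
               C * traceless_ricci_energy g < scalar_deviation g]) /\
  (forall C : R, C < n%:R ^+ 2 / (n%:R - 2) ^+ 2 ->
     exists f : sphere R n -> R,
       is_laplace_eigenfunction round_metric f /\
       exists t0 : R, 0 < t0 /\
         forall t : R, 0 < t -> t < t0 ->
           let g := conformal (fun p => 1 + t * f p) round_metric in
           [/\ is_riemannian_metric g, nonneg_ricci g &
               C * traceless_ricci_energy g < einstein_deviation g]).
Proof.
have m3 : 3 <= n%:R :> R by rewrite ler_nat.
split=> C HC.
  have [f [eigf [t0 [t0_gt0 H]]]] := zonal_deformation hn HC.
  exists f; split=> //; exists t0; split=> // t t1 t2 g.
  by have [] := H t t1 t2.
(* With T and S the traceless and scalar energies, C T < T + S/n means n(C-1) T < S. The thresholds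
   correspond because n^2 - (n-2)^2 = 4(n-1). *)
have HC' : n%:R * (C - 1) < 4 * n%:R * (n%:R - 1) / (n%:R - 2) ^+ 2.
  rewrite (_ : _ / _ = n%:R * (n%:R ^+ 2 / (n%:R - 2) ^+ 2 - 1)).
    by rewrite ltr_pM2l ?ltrD2r//; lra.
  by field; lra.
have [f [eigf [t0 [t0_gt0 H]]]] := zonal_deformation hn HC'.
exists f; split=> //; exists t0; split=> // t t1 t2 g.
have [gm gr lt_g ->] := H t t1 t2; split=> //.
rewrite -/g in lt_g *; rewrite -subr_gt0.
rewrite (_ : _ - _ = (scalar_deviation g
  - n%:R * (C - 1) * traceless_ricci_energy g) / n%:R); last by field; lra.
by rewrite divr_gt0 ?subr_gt0//; lra.
Qed.
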